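(* Let $\mathcal{H}$ be generated by an exponential decay kernel, $\mu_i\asymp\exp(-\gamma i^p)$ with $\gamma>0$, $p\ge1$. Suppose that Assumption A2 holds for $\lambda\asymp\lambda^*:=(\log n)^{1/(2p)}n^{-1}$ and $c_1,c_2\in(0,\infty]$. Then for any $\varepsilon>0$ there exist constants $C_\varepsilon$ and $N_\varepsilon$ such that, with probability greater than $1-e^{-c_{\gamma,p}n(\log n)^{-2/p}}-e^{-c_1s}-e^{-c_2s_\lambda}$, $$\inf_{n\ge N_\varepsilon}\ \inf_{\substack{f\in\mathcal{B}\\ \|f\|_n\ge C_\varepsilon n^{-\frac12}(\log n)^{\frac{1}{4p}}}}P_f(\phi_{n,\lambda}=1\mid\boldsymbol{x},S)\ge1-\varepsilon,$$ where $c_{\gamma,p}$ is a constant depending on $\gamma,p$, $\mathcal{B}=\{f\in\mathcal{H}:\|f\|_{\mathcal{H}}\le C\}$ for a constant $C$, and $P_f(\cdot\mid\boldsymbol{x},S)$ is the conditional probability measure under $f$ given $\boldsymbol{x}=(x_1,\dots,x_n)$ and $S$.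
   Context: Model: $y_i=f(x_i)+\epsilon_i$, $i=1,\dots,n$, where $x_1,\dots,x_n$ are i.i.d. from a distribution $P_X$ on $\mathcal{X}\subseteq\mathbb{R}^d$ ($d\ge1$ fixed), $\epsilon_i$ are i.i.d. $N(0,1)$ and independent of $(x_1,\dots,x_n)$ and $S$, and $f\in\mathcal{H}$. Kernel: $\mathcal{H}\subset L^2(P_X)$ is an RKHS with inner product $\langle\cdot,\cdot\rangle_{\mathcal{H}}$ and reproducing kernel $K(x,x')=\sum_{i=1}^\infty\mu_i\phi_i(x)\phi_i(x')$, with ordered eigenvalues $\mu_1\ge\mu_2\ge\cdots\ge0$, where $\{\phi_i\}$ is a basis of $L^2(P_X)$ with $\langle\phi_i,\phi_j\rangle_{L^2(P_X)}=\delta_{ij}$ and $\langle\phi_i,\phi_j\rangle_{\mathcal{H}}=\delta_{ij}/\mu_i$. Assumption A1 (standing): $\sup_{i\ge1}\|\phi_i\|_{\sup}<\infty$ and $\sup_{k\ge1}\frac{\sum_{i=k+1}^\infty\mu_i}{k\mu_k}<\infty$. Estimator and test of $H_0:f=0$ versus $H_1:f\in\mathcal{H}\setminus\{0\}$: $\boldsymbol{K}=[n^{-1}K(x_i,x_j)]_{1\le i,j\le n}$, $\boldsymbol{y}=(y_1,\dots,y_n)^\top$; for an $s\times n$ real random matrix $S$, $\widehat\beta=\frac1n(S\boldsymbol{K}^2S^\top+\lambda S\boldsymbol{K}S^\top)^{-1}S\boldsymbol{K}\boldsymbol{y}$, $\widehat f_R(\cdot)=\sum_{i=1}^n(S^\top\widehat\beta)_iK(\cdot,x_i)$,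 $T_{n,\lambda}=\|\widehat f_R\|_n^2$ with $\|g\|_n^2=\frac1n\sum_{i=1}^ng(x_i)^2$. With $\Delta=\boldsymbol{K}S^\top(S\boldsymbol{K}^2S^\top+\lambda S\boldsymbol{K}S^\top)^{-1}S\boldsymbol{K}$, set $\mu_{n,\lambda}=\mathrm{tr}(\Delta^2)/n$ and $\sigma_{n,\lambda}^2=2\,\mathrm{tr}(\Delta^4)/n^2$ with $\sigma_{n,\lambda}\ge0$. The test at significance level $\alpha$ is $\phi_{n,\lambda}=I(|T_{n,\lambda}-\mu_{n,\lambda}|\ge z_{1-\alpha/2}\sigma_{n,\lambda})$, $z_{1-\alpha/2}$ being the $100(1-\alpha/2)$th percentile of $N(0,1)$. Let $\boldsymbol{K}=UDU^\top$, $UU^\top=I_n$, $D=\mathrm{diag}(\widehat\mu_1,\dots,\widehat\mu_n)$, $\widehat\mu_1\ge\cdots\ge\widehat\mu_n\ge0$. Let $\widehat s_\lambda=\min\{i:\widehat\mu_i\le\lambda\}-1$ and $s_\lambda=\min\{i:\mu_i\le\lambda\}-1$. Write $U=(U_1,U_2)$ with $U_1$ the first $\widehat s_\lambda$ columns, and $D_2=\mathrm{diag}(\widehat\mu_{\widehat s_\lambda+1},\dots,\widehat\mu_n)$. $S$ is $\boldsymbol{K}$-satisfiable if there is a constant $c>0$ with $\|(SU_1)^\top SU_1-I_{\widehat s_\lambda}\|_{\mathrm{op}}\le1/2$ and $\|SU_2D_2^{1/2}\|_{\mathrm{op}}\le c\lambda^{1/2}$. An event $\mathcal{E}$ is of $(a,b)$-type,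 $a,b\in(0,\infty]$, if $P(P(\mathcal{E}\mid x_1,\dots,x_n)\ge1-e^{-a})\ge1-e^{-b}$. Assumption A2: (a) $s\ge ds_\lambda$ for a sufficiently large constant $d>0$; (b) there exist $c_1,c_2\in(0,\infty]$ such that the event ''$S$ is $\boldsymbol{K}$-satisfiable'' is of $(c_1s,c_2s_\lambda)$-type. *)

(* Defs.v *)
From HB Require Import structures.
From mathcomp Require Import all_boot all_order all_algebra finmap.
From mathcomp Require Import all_classical all_reals all_analysis.
From mathcomp Require Import measurable_realfun.

Set Implicit Arguments.
Unset Strict Implicit.
Unset Printing Implicit Defensive.

Import Order.TTheory GRing.Theory Num.Theory.
Import numFieldNormedType.Exports.

Local Open Scope classical_set_scope.
Local Open Scope ring_scope.

(* R^d is [d.-tuple R].  A function on a domain X of R^d is a function on R^d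
   of which only the values on X matter.  The eigenvalues mu_1, mu_2, ... and
   eigenfunctions phi_1, phi_2, ... are indexed from 0, so that mu_i is
   [mu i.-1]; likewise the design points x_1, ..., x_n are [x 0], ..., [x n.-1].
*)

Section kernel.
Context {R : realType} {d : nat}.
Local Notation pt := (d.-tuple R).

(* [ip] is only meaningful on [H].  [rkhs_ip_def] identifies two members of H
   exactly when they agree on X. *)
Record is_rkhs (X : set pt) (H : set (pt -> R))
    (ip : (pt -> R) -> (pt -> R) -> R) (K : pt -> pt -> R) : Prop := {
  rkhs_zero : H 0 ;
  rkhs_lin : forall (a : R) f g, H f -> H g -> H (a *: f + g) ;
  rkhs_ip_lin : forall (a : R) f g h, H f -> H g -> H h ->
    ip (a *: f + g) h = a * ip f h + ip g h ;
  rkhs_ip_sym : forall f g, H f -> H g -> ip f g = ip g f ;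
  rkhs_ip_ge0 : forall f, H f -> 0 <= ip f f ;
  rkhs_ip_def : forall f, H f -> ip f f = 0 <-> (forall x, X x -> f x = 0) ;
  rkhs_complete : forall u : nat -> pt -> R, (forall k, H (u k)) ->
    (forall e : R, 0 < e -> exists N, forall k l, (N <= k)%N -> (N <= l)%N ->
       ip (u k - u l) (u k - u l) <= e) ->
    exists2 f, H f & (fun k => ip (u k - f) (u k - f)) @ \oo --> (0 : R) ;
  rkhs_kernel : forall x, X x -> H (K ^~ x) ;
  rkhs_reproducing : forall f x, H f -> X x -> ip f (K ^~ x) = f x }.

Definition in_L2 (X : set pt) (PX : probability pt R) (f : pt -> R) : Prop :=
  measurable_fun X f /\ (\int[PX]_(x in X) ((f x) ^+ 2)%:E < +oo)%E.

Definition L2ip (X : set pt) (PX : probability pt R) (f g : pt -> R) : R :=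
  Rintegral PX X (fun x => f x * g x).

Definition L2_orthonormal_basis (X : set pt) (PX : probability pt R)
    (phi : nat -> pt -> R) : Prop :=
  [/\ forall i, in_L2 X PX (phi i),
      forall i j, L2ip X PX (phi i) (phi j) = (i == j)%:R
    & forall g, in_L2 X PX g ->
        (fun N => let h := g - \sum_(i < N) L2ip X PX g (phi i) *: phi i in
                  L2ip X PX h h) @ \oo --> (0 : R)].

Record is_eigensystem (X : set pt) (PX : probability pt R)
    (H : set (pt -> R)) (ip : (pt -> R) -> (pt -> R) -> R)
    (K : pt -> pt -> R) (mu : nat -> R) (phi : nat -> pt -> R) : Prop := {
  eigen_ge0 : forall i, 0 <= mu i ;
  eigen_noninc : forall i j, (i <= j)%N -> mu j <= mu i ;
  eigen_H : forall i, H (phi i) ;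
  eigen_L2 : L2_orthonormal_basis X PX phi ;
  eigen_ip : forall i j, ip (phi i) (phi j) = (i == j)%:R / mu i ;
  eigen_mercer : forall x y, X x -> X y ->
    series (fun i => mu i * phi i x * phi i y) @ \oo --> K x y }.

(* The second bound is sup_k (\sum_(i > k) mu_i) / (k * mu_k) < oo, in 0-based
   indices and with the denominator cleared. *)
Definition assumption_A1 (X : set pt) (mu : nat -> R) (phi : nat -> pt -> R)
  : Prop :=
  (exists M : R, forall i x, X x -> `|phi i x| <= M) /\
  (exists M : R, forall k,
     (\sum_(k.+1 <= i <oo) (mu i)%:E <= (M * (k.+1%:R * mu k))%:E)%E).

End kernel.

Section linear_algebra.
Context {R : realType}.

Definition l2norm n (v : 'cV[R]_n) : R := Num.sqrt (\sum_i v i 0 ^+ 2).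

Definition opnorm m n (A : 'M[R]_(m, n)) : R :=
  sup [set l2norm (A *m v) | v in [set v : 'cV[R]_n | l2norm v <= 1]].

Definition head_ord k n (kn : (k <= n)%N) (j : 'I_k) : 'I_n := widen_ord kn j.

Fact tail_ord_proof k n (j : 'I_(n - k)) : (k + j < n)%N.
Proof. by rewrite -ltn_subRL ltn_ord. Qed.

Definition tail_ord k n (j : 'I_(n - k)) : 'I_n := Ordinal (tail_ord_proof j).

(* [find] returns the 0-based position of the first entry <= lam, which is
   min {i : muhat_i <= lam} - 1 for 1-based i; it returns n if all entries
   exceed lam. *)
Definition shat n (lam : R) (D : 'rV[R]_n) : nat :=
  find (fun m => m <= lam) [seq D 0 i | i <- enum 'I_n].

Fact shat_le n (lam : R) (D : 'rV[R]_n) : (shat lam D <= n)%N.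
Proof.
by rewrite /shat (leq_trans (find_size _ _))// size_map size_enum_ord.
Qed.

(* min {i >= 1 : mu_i <= lam} - 1, i.e. the 0-based position of the first
   eigenvalue <= lam; the default 0 is only used if there is none. *)
Definition slam (mu : nat -> R) (lam : R) : nat :=
  xget 0%N [set k | mu k <= lam /\ forall j, (j < k)%N -> lam < mu j].

Definition is_spectral_decomposition n (A U : 'M[R]_n) (D : 'rV[R]_n) : Prop :=
  [/\ A = U *m diag_mx D *m U^T, U *m U^T = 1%:M,
      forall i j : 'I_n, (i <= j)%N -> D 0 j <= D 0 i
    & forall i, 0 <= D 0 i].

(* Neither condition depends on the chosen decomposition: the threshold lam
   never splits an eigenspace of A, so another choice replaces U1 by U1 *m Q
   with Q orthogonal, and similarly for U2 within each eigenspace. *)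
Definition satisfiable n s (A : 'M[R]_n) (lam c : R) (S : 'M[R]_(s, n))
  : Prop :=
  exists U D, is_spectral_decomposition A U D /\
    let U1 := colsub (head_ord (shat_le lam D)) U in
    let U2 := colsub (@tail_ord (shat lam D) n) U in
    let D2 := colsub (@tail_ord (shat lam D) n) D in
    opnorm ((S *m U1)^T *m (S *m U1) - 1%:M) <= 2^-1 /\
    opnorm (S *m U2 *m diag_mx (map_mx Num.sqrt D2)) <= c * Num.sqrt lam.

End linear_algebra.

Section estimator.
Context {R : realType} {d : nat}.
Local Notation pt := (d.-tuple R).

Definition gram n (K : pt -> pt -> R) (xs : 'I_n -> pt) : 'M[R]_n :=
  \matrix_(i, j) (n%:R^-1 * K (xs i) (xs j)).

Definition emp_norm n (xs : 'I_n -> pt) (g : pt -> R) : R :=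
  Num.sqrt (n%:R^-1 * \sum_i g (xs i) ^+ 2).

Definition sketched n s (A : 'M[R]_n) (lam : R) (S : 'M[R]_(s, n)) : 'M[R]_s :=
  S *m A ^+ 2 *m S^T + lam *: (S *m A *m S^T).

Definition beta_hat n s (A : 'M[R]_n) (lam : R) (S : 'M[R]_(s, n))
    (y : 'cV[R]_n) : 'cV[R]_s :=
  n%:R^-1 *: (invmx (sketched A lam S) *m S *m A *m y).

Definition f_hat n s (K : pt -> pt -> R) (xs : 'I_n -> pt) (lam : R)
    (S : 'M[R]_(s, n)) (y : 'cV[R]_n) : pt -> R :=
  fun x => \sum_i (S^T *m beta_hat (gram K xs) lam S y) i 0 * K x (xs i).

Definition T_stat n s (K : pt -> pt -> R) (xs : 'I_n -> pt) (lam : R)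
    (S : 'M[R]_(s, n)) (y : 'cV[R]_n) : R :=
  emp_norm xs (f_hat K xs lam S y) ^+ 2.

Definition Delta n s (A : 'M[R]_n) (lam : R) (S : 'M[R]_(s, n)) : 'M[R]_n :=
  A *m S^T *m invmx (sketched A lam S) *m S *m A.

Definition mu_stat n s (A : 'M[R]_n) (lam : R) (S : 'M[R]_(s, n)) : R :=
  \tr (Delta A lam S ^+ 2) / n%:R.

Definition sigma_stat n s (A : 'M[R]_n) (lam : R) (S : 'M[R]_(s, n)) : R :=
  Num.sqrt (2 * \tr (Delta A lam S ^+ 4) / n%:R ^+ 2).

Definition normal_quantile (q : R) : R :=
  inf [set t : R | (q%:E <= normal_prob 0 1 `]-oo, t])%E].

(* [true] when H_0 is rejected at level alpha *)
Definition test n s (alpha : R) (K : pt -> pt -> R) (xs : 'I_n -> pt) (lam : R)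
    (S : 'M[R]_(s, n)) (y : 'cV[R]_n) : bool :=
  normal_quantile (1 - alpha / 2) * sigma_stat (gram K xs) lam S
    <= `| T_stat K xs lam S y - mu_stat (gram K xs) lam S |.

End estimator.

Section probability.
Context {R : realType} {dO : measure_display} {Omega : measurableType dO}.
Variable P : probability Omega R.

Definition mutually_independent d' (T : measurableType d')
    (Y : nat -> {RV P >-> T}) : Prop :=
  forall (J : {fset nat}) (B : nat -> set T), (forall i, measurable (B i)) ->
    P (\bigcap_(i in [set` J]) (Y i @^-1` B i)) =
    (\prod_(i <- J) P (Y i @^-1` B i))%E.

Definition independent_sigma (G1 G2 : set (set Omega)) : Prop :=
  forall A B, G1 A -> G2 B -> P (A `&` B) = (P A * P B)%E.

Definition iid d' (T : measurableType d') (Y : nat -> {RV P >-> T})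
    (Q : set T -> \bar R) : Prop :=
  mutually_independent Y /\
  forall i B, measurable B -> distribution P (Y i) B = Q B.

Definition sigma_rv (I : Type) (J : set I) d' (T : measurableType d')
    (Y : I -> Omega -> T) : set (set Omega) :=
  <<s \bigcup_(i in J) preimage_set_system setT (Y i) measurable >>.

(* [g] is a version of the conditional probability of [E] given the
   sigma-algebra [G]. *)
Definition is_cond_prob (G : set (set Omega)) (E : set Omega)
    (g : Omega -> \bar R) : Prop :=
  [/\ forall B : set (\bar R), measurable B -> G (g @^-1` B),
      P.-integrable setT g
    & forall A, G A -> (\int[P]_(w in A) g w = P (E `&` A))%E].

(* P(P(E | G) >= 1 - e^-a) >= 1 - e^-b.  Versions of P(E | G) exist and agree
   almost surely, so it does not matter which one is used. *)
Definition of_type (G : set (set Omega)) (a b : \bar R) (E : set Omega)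
  : Prop :=
  [/\ (0 < a)%E, (0 < b)%E, measurable E
    & exists2 g, is_cond_prob G E g
      & (1 - expeR (- b) <= P [set w | 1 - expeR (- a) <= g w])%E].

(* [kap] is a regular conditional distribution given [G] of [Y]. *)
Definition is_regular_cond_dist (G : set (set Omega)) d'
    (T : measurableType d') (Y : Omega -> T) (kap : Omega -> probability T R)
  : Prop :=
  forall B, measurable B -> is_cond_prob G (Y @^-1` B) (fun w => kap w B).

End probability.

Section model.
Context {R : realType} {d : nat} {dO : measure_display}
  {Omega : measurableType dO} (P : probability Omega R).
Local Notation pt := (d.-tuple R).
Variables (x : nat -> {RV P >-> pt}) (noise : nat -> {RV P >-> R})
  (s : nat -> nat) (S : forall n, Omega -> 'M[R]_(s n, n)).

Definition design n (w : Omega) : 'I_n -> pt := fun i => x i w.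

Definition noise_tuple n (w : Omega) : n.-tuple R := [tuple noise i w | i < n].

Definition sigma_x n : set (set Omega) := sigma_rv `I_n x.

Definition sigma_noise n : set (set Omega) := sigma_rv `I_n noise.

Definition sigma_S n : set (set Omega) :=
  sigma_rv setT (fun (ij : 'I_(s n) * 'I_n) w => S n w ij.1 ij.2).

Definition sigma_xS n : set (set Omega) := <<s sigma_x n `|` sigma_S n >>.

Record is_model (X : set pt) (PX : probability pt R) : Prop := {
  model_x_dom : forall i w, X (x i w) ;
  model_x_iid : iid x PX ;
  model_noise_iid : iid noise (normal_prob 0 1) ;
  model_S_meas : forall n i j, measurable_fun setT (fun w => S n w i j) ;
  model_indep : forall n, independent_sigma P (sigma_noise n) (sigma_xS n) }.

Definition sketch_satisfiable (K : pt -> pt -> R) (lam : nat -> R) (c : R) n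
  : set Omega :=
  [set w | satisfiable (gram K (@design n w)) (lam n) c (S n w)].

(* The matrix inverted in [beta_hat] and [Delta] is almost surely invertible;
   [invmx] is a junk value otherwise. *)
Definition estimator_well_defined (K : pt -> pt -> R) (lam : nat -> R) n
  : Prop :=
  {ae P, forall w, sketched (gram K (@design n w)) (lam n) (S n w) \in unitmx}.

(* [c] is the constant in [satisfiable], common to all n and all outcomes. *)
Definition assumption_A2 (K : pt -> pt -> R) (mu lam : nat -> R)
    (dd c : R) (c1 c2 : \bar R) n : Prop :=
  dd * (slam mu (lam n))%:R <= (s n)%:R /\
  of_type P (sigma_x n) (c1 * (s n)%:R%:E)%E (c2 * (slam mu (lam n))%:R%:E)%E
    (sketch_satisfiable K lam c n).

(* the f in the ball of radius C of H at empirical distance >= r from 0 *)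
Definition alternatives (H : set (pt -> R)) (ip : (pt -> R) -> (pt -> R) -> R)
    (C r : R) n (w : Omega) : set (pt -> R) :=
  [set f | [/\ H f, Num.sqrt (ip f f) <= C & r <= emp_norm (@design n w) f]].

Definition response n (w : Omega) (f : pt -> R) (e : n.-tuple R) : 'cV[R]_n :=
  \col_i (f (@design n w i) + tnth e i).

(* P_f(test rejects | x, S) at the outcome [w]: the data x and S are those of
   [w], and y = f(x) + noise where the noise is distributed according to its
   regular conditional distribution [kap] given (x, S).  Using one [kap] for
   all f gives conditional probability measures P_f(. | x, S) that are
   simultaneously defined for the uncountably many f of an infimum. *)
Definition cond_power (kap : forall n, Omega -> probability (n.-tuple R) R)
    (alpha : R) (K : pt -> pt -> R) (lam : nat -> R) n (w : Omega)
    (f : pt -> R) : \bar R :=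
  kap n w [set e | test alpha K (@design n w) (lam n) (S n w) (response w f e)].

End model.

(* Main.v *)
From HB Require Import structures.
Require Import Defs.
From mathcomp Require Import all_boot all_order all_algebra finmap.
From mathcomp Require Import all_classical all_reals all_analysis.
From mathcomp Require Import measurable_realfun.
From mathcomp Require Import ring lra.

(** Write A for the empirical kernel matrix, f also for the vector of the values
of the regression function at the design points, and M for the matrix
S A^2 S^T + lam S A S^T. The fitted vector is Delta y with
Delta = A S^T M^-1 S A, so n T = |Delta y|^2 and, for y = f + e,

  T - mu = W + (centered quadratic polynomial in e),   W = |Delta f|^2 / n.

With Gaussian noise the centered part has variance at most sigma^2 + 4 W / n
(exists_gaussian_tuple, centered_statistic_variance). By Chebyshev's inequality
the test rejects with conditional probability close to 1 as soon as W is a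
large multiple of both sigma and 1 / n (power_bound). It remains to compare
these quantities with r = (log n)^(1/(2p)) / n, the order of lam.

The bias. Delta f solves a ridge problem over the range of S^T (ridge_optimal).
The reproducing property says that f f^T <= n |f|_H^2 A (rkhs_eval_le). When S
is satisfiable, some b makes A S^T b agree with f on the eigenvectors of A with
eigenvalue above lam, with an error of order lam |f|_H^2 elsewhere
(satisfiable_bias). Hence |f - Delta f|^2 / n is of order lam, and W is at least
half of |f|_n^2 minus a multiple of r.

The standard deviation. One has Delta^4 <= Delta <= A (A + lam)^-1. If A
dominates a matrix of rank k, then
tr Delta <= k + (trace of the remainder) / lam (mxtrace_Delta_le). Mercer's
expansion provides such a matrix, and because the eigenfunctions are uniformly
bounded, the trace of the remainder is at most a multiple of the tail of the
eigenvalues at every design (mercer_tail_le): no concentration inequality is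
involved. Under exponential decay mu_k <= lam for some k of order
(log n)^(1/p) (exponential_decay_count), whence sigma^2 is of order
(log n)^(1/p) / n^2 = r^2.

The event. Everything above holds at each outcome where S is satisfiable, M is
invertible and the given conditional law of the noise is N(0,1)^n. The last two
conditions hold almost surely; for the conditional law this is independence on
countably many orthants, which determine a law on R^n (kernel_ae_gaussian). The
first one has probability at least 1 - e^(-c1 s) - e^(-c2 s_lam)
(of_type_probability). The additional term of the announced probability then
makes the inequality strict, with any constant c_gp. *)

Set Implicit Arguments.
Unset Strict Implicit.
Unset Printing Implicit Defensive.
Import Order.TTheory GRing.Theory Num.Theory.
Import numFieldNormedType.Exports.

Local Open Scope classical_set_scope.
Local Open Scope ring_scope.

(** * Euclidean inner product and operator norm *)

Section dot_product.
Context {R : realType}.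
Implicit Types m n k : nat.

Definition dot n (u v : 'cV[R]_n) : R := (u^T *m v) 0 0.

Lemma dotE n (u v : 'cV[R]_n) : dot u v = \sum_i u i 0 * v i 0.
Proof. by rewrite /dot !mxE; apply: eq_bigr => i _; rewrite !mxE. Qed.

Lemma dotC n (u v : 'cV[R]_n) : dot u v = dot v u.
Proof. by rewrite !dotE; apply: eq_bigr => i _; rewrite mulrC. Qed.

Lemma dotDr n (u v w : 'cV[R]_n) : dot u (v + w) = dot u v + dot u w.
Proof. by rewrite /dot mulmxDr mxE. Qed.

Lemma dotDl n (u v w : 'cV[R]_n) : dot (v + w) u = dot v u + dot w u.
Proof. by rewrite !(dotC _ u) dotDr. Qed.

Lemma dotZr n (u v : 'cV[R]_n) a : dot u (a *: v) = a * dot u v.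
Proof. by rewrite /dot -scalemxAr mxE. Qed.

Lemma dotZl n (u v : 'cV[R]_n) a : dot (a *: u) v = a * dot u v.
Proof. by rewrite !(dotC _ v) dotZr. Qed.

Lemma dotNr n (u v : 'cV[R]_n) : dot u (- v) = - dot u v.
Proof. by rewrite -scaleN1r dotZr mulN1r. Qed.

Lemma dotNl n (u v : 'cV[R]_n) : dot (- u) v = - dot u v.
Proof. by rewrite -scaleN1r dotZl mulN1r. Qed.

Definition dot_lin := (dotDl, dotDr, dotNl, dotNr, dotZl, dotZr).

Lemma dot_mulmxl m n (A : 'M[R]_(m, n)) u v : dot (A *m u) v = dot u (A^T *m v).
Proof. by rewrite /dot trmx_mul mulmxA. Qed.

Lemma dot_mulmxr m n (A : 'M[R]_(m, n)) u v : dot v (A *m u) = dot (A^T *m v) u.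
Proof. by rewrite dotC dot_mulmxl dotC. Qed.

Lemma dot_ge0 n (u : 'cV[R]_n) : 0 <= dot u u.
Proof. by rewrite dotE sumr_ge0// => i _; rewrite -expr2 sqr_ge0. Qed.

Lemma dot_eq0 n (u : 'cV[R]_n) : dot u u = 0 -> u = 0.
Proof.
rewrite dotE => u0; apply/colP => i; rewrite mxE; apply/eqP.
rewrite -sqrf_eq0 expr2 (psumr_eq0P _ u0)// => j _.
by rewrite -expr2 sqr_ge0.
Qed.

Lemma dot_CauchySchwarz n (u v : 'cV[R]_n) :
  dot u v ^+ 2 <= dot u u * dot v v.
Proof.
have [/dot_eq0->|v0] := eqVneq (dot v v) 0.
  by rewrite /dot !mulmx0 !mxE expr0n mulr0.
have vgt0 : 0 < dot v v by rewrite lt0r v0 dot_ge0.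
have := dot_ge0 (u - (dot u v / dot v v) *: v).
rewrite !dot_lin (dotC v u) => h.
rewrite -ler_pdivrMr//.
move: h; move: (dot u v) (dot u u) (dot v v) v0 => q a b b0 h.
suff : q ^+ 2 / b = a - (a - q / b * q - (q / b * q - q / b * (q / b * b))).
  by lra.
by field.
Qed.

Lemma dot_delta n (i : 'I_n) (v : 'cV[R]_n) : dot (delta_mx i 0) v = v i 0.
Proof.
rewrite dotE (bigD1 i)//= big1 ?addr0 => [|j ji].
  by rewrite mxE !eqxx mul1r.
by rewrite mxE (negbTE ji) mul0r.
Qed.

Lemma mxtrace_dot n (A : 'M[R]_n) :
  \tr A = \sum_i dot (delta_mx i 0) (A *m delta_mx i 0).
Proof.
apply: eq_bigr => i _.
rewrite dot_delta mxE (bigD1 i)//= big1 ?addr0 => [|j ji].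
  by rewrite mxE !eqxx mulr1.
by rewrite mxE (negbTE ji) mulr0.
Qed.

Lemma l2normE n (v : 'cV[R]_n) : l2norm v = Num.sqrt (dot v v).
Proof. by rewrite /l2norm dotE; congr Num.sqrt; apply: eq_bigr => i _. Qed.

Lemma l2norm_ge0 n (v : 'cV[R]_n) : 0 <= l2norm v.
Proof. exact: sqrtr_ge0. Qed.

Lemma sqr_l2norm n (v : 'cV[R]_n) : l2norm v ^+ 2 = dot v v.
Proof. by rewrite l2normE sqr_sqrtr// dot_ge0. Qed.

Lemma dot_le_l2norm n (u v : 'cV[R]_n) : `|dot u v| <= l2norm u * l2norm v.
Proof.
rewrite -(@ler_pXn2r _ 2)// ?nnegrE ?mulr_ge0 ?l2norm_ge0//.
by rewrite exprMn !sqr_l2norm real_normK ?num_real// dot_CauchySchwarz.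
Qed.

Lemma l2normZ n a (v : 'cV[R]_n) : l2norm (a *: v) = `|a| * l2norm v.
Proof.
by rewrite !l2normE !dot_lin mulrA -expr2 sqrtrM ?sqr_ge0// sqrtr_sqr.
Qed.

(** This makes the set whose supremum defines opnorm bounded. *)
Lemma dot_mulmx_le_frobenius m n (A : 'M[R]_(m, n)) (v : 'cV[R]_n) :
  dot (A *m v) (A *m v) <= (\sum_i dot (row i A)^T (row i A)^T) * dot v v.
Proof.
rewrite [leLHS]dotE mulr_suml; apply: ler_sum => i _.
have -> : (A *m v) i 0 = dot (row i A)^T v.
  by rewrite dotE mxE; apply: eq_bigr => j _; rewrite !mxE.
by rewrite -expr2 dot_CauchySchwarz.
Qed.

Lemma le_opnorm m n (A : 'M[R]_(m, n)) (v : 'cV[R]_n) :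
  l2norm (A *m v) <= opnorm A * l2norm v.
Proof.
set F := \sum_i dot (row i A)^T (row i A)^T.
have ub (u : 'cV[R]_n) : l2norm u <= 1 -> l2norm (A *m u) <= opnorm A.
  move=> u1; apply: ub_le_sup; last by exists u.
  exists (Num.sqrt F) => _ [w /= w1 <-].
  rewrite l2normE ler_wsqrtr// (le_trans (dot_mulmx_le_frobenius _ _))//.
  rewrite ler_piMr ?sumr_ge0// => [i _|]; first exact: dot_ge0.
  by rewrite -sqr_l2norm expr_le1// l2norm_ge0.
have [v0|v0] := eqVneq (l2norm v) 0.
  have -> : v = 0 by apply: dot_eq0; rewrite -sqr_l2norm v0 expr0n.
  by rewrite mulmx0 !l2normE /dot !mulmx0 mxE sqrtr0 mulr0.
have vgt0 : 0 < l2norm v by rewrite lt0r v0 l2norm_ge0.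
have := ub ((l2norm v)^-1 *: v).
rewrite l2normZ ger0_norm ?invr_ge0 ?l2norm_ge0// mulVf// => /(_ (lexx _)).
rewrite -scalemxAr l2normZ ger0_norm ?invr_ge0 ?l2norm_ge0//.
by rewrite mulrC ler_pdivrMr.
Qed.

(** A matrix and its transpose have the same operator norm:
|A^T v|^2 = v . A (A^T v) <= |v| |A| |A^T v|. *)
Lemma dot_trmx_le m n (A : 'M[R]_(m, n)) (v : 'cV[R]_m) b : opnorm A <= b ->
  dot (A^T *m v) (A^T *m v) <= b ^+ 2 * dot v v.
Proof.
move=> Ab.
have h : l2norm (A^T *m v) ^+ 2 <= l2norm v * (b * l2norm (A^T *m v)).
  rewrite sqr_l2norm dot_mulmxl trmxK.
  apply: le_trans (ler_norm _) _; apply: le_trans (dot_le_l2norm _ _) _.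
  rewrite ler_wpM2l ?l2norm_ge0//; apply: le_trans (le_opnorm _ _) _.
  by rewrite ler_wpM2r ?l2norm_ge0.
rewrite -!sqr_l2norm; move: h (l2norm_ge0 (A^T *m v)) (l2norm_ge0 v).
move: (l2norm _) (l2norm _) => t w; rewrite le0r => h /orP[/eqP->|t0] w0.
  by rewrite expr0n/= mulr_ge0// sqr_ge0.
rewrite -exprMn ler_pXn2r ?nnegrE ?(ltW t0)//.
  by rewrite -(ler_pM2r t0) mulrCA -mulrA -expr2 in h *.
by move: h; rewrite expr2 mulrA ler_pM2r// mulrC; apply: le_trans; exact: ltW.
Qed.

End dot_product.

(** * Sketched ridge regression *)

Section sketched_ridge.
Context {R : realType} {n s : nat}.
Variables (A : 'M[R]_n) (S : 'M[R]_(s, n)) (lam : R).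
Hypotheses (A_sym : A^T = A) (A_ge0 : forall v, 0 <= dot v (A *m v)).
Hypotheses (lam_gt0 : 0 < lam) (M_unit : sketched A lam S \in unitmx).

Local Notation M := (sketched A lam S).
Local Notation Delta := (Delta A lam S).

(** Delta = A H A for this H, which satisfies the Riccati-type identity
H = H A^2 H + lam H A H. *)
Definition ridge_core := S^T *m invmx M *m S.
Local Notation H := ridge_core.

Lemma sketchedE : M = S *m A *m A *m S^T + lam *: (S *m A *m S^T).
Proof. by rewrite /sketched -[S *m A *m A]mulmxA. Qed.

Lemma sketched_sym : M^T = M.
Proof.
by rewrite sketchedE linearD linearZ/= !trmx_mul trmxK A_sym !mulmxA.
Qed.

Lemma ridge_core_sym : H^T = H.
Proof. by rewrite !trmx_mul trmxK trmx_inv sketched_sym mulmxA. Qed.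

Lemma ridge_core_eq : H *m A *m A *m H + lam *: (H *m A *m H) = H.
Proof.
transitivity (S^T *m (invmx M *m M) *m invmx M *m S).
  rewrite /ridge_core; move: (invmx M) => N.
  by rewrite sketchedE !(mulmxDl, mulmxDr) -!(scalemxAr, scalemxAl) !mulmxA.
by rewrite mulVmx// mulmx1.
Qed.

Lemma DeltaE : Delta = A *m H *m A.
Proof. by rewrite /Defs.Delta !mulmxA. Qed.

Lemma Delta_sym : Delta^T = Delta.
Proof. by rewrite DeltaE trmx_mul (trmx_mul A) ridge_core_sym A_sym mulmxA. Qed.

(** This exhibits Delta - Delta^2 as a positive semidefinite matrix, from which
0 <= Delta <= 1 follows. *)
Lemma Delta_minus_sqr :
  Delta - Delta *m Delta = lam *: (A *m H *m A *m H *m A).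
Proof.
rewrite DeltaE -[in X in X - _]ridge_core_eq !(mulmxDl, mulmxDr).
by rewrite -!(scalemxAr, scalemxAl) !mulmxA addrAC subrr add0r.
Qed.

Lemma dot_Delta_le v : dot (Delta *m v) (Delta *m v) <= dot v (Delta *m v).
Proof.
rewrite dot_mulmxl Delta_sym mulmxA -subr_ge0 -dotNr -dotDr -mulNmx -mulmxDl.
rewrite Delta_minus_sqr -scalemxAl dotZr mulr_ge0 ?(ltW lam_gt0)//.
have -> : A *m H *m A *m H *m A *m v = A *m H *m (A *m (H *m A *m v)).
  by rewrite !mulmxA.
by rewrite dot_mulmxr trmx_mul ridge_core_sym A_sym.
Qed.

Lemma dot_Delta_contract v : dot (Delta *m v) (Delta *m v) <= dot v v.
Proof.
have := dot_ge0 (v - Delta *m v); rewrite !dot_lin (dotC (_ *m _) v).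
by have := dot_Delta_le v; lra.
Qed.

Lemma mxtrace_Delta4_le : \tr (Delta ^+ 4) <= \tr Delta.
Proof.
move: (Delta_sym) (dot_Delta_le) (dot_Delta_contract).
move: (Defs.Delta A lam S) => D D_sym D_le D_contr.
rewrite !mxtrace_dot; apply: ler_sum => i _; set e := delta_mx _ _.
apply: le_trans (D_le e).
have -> : D ^+ 4 *m e = D *m (D *m (D *m (D *m e)))
  by rewrite -[D ^+ 4]/(D *m (D *m (D *m D))) !mulmxA.
by rewrite dot_mulmxr D_sym dot_mulmxr D_sym D_contr.
Qed.

(** Delta f = A S^T b0 where b0 minimizes the right-hand side over b; normal_eq
is the vanishing of the gradient at b0, and completing the square gives the
inequality. The penalty at b0 is dropped from the left-hand side. *)
Lemma ridge_optimal (f : 'cV[R]_n) (b : 'cV[R]_s) :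
  dot (f - Delta *m f) (f - Delta *m f) <=
  dot (f - A *m (S^T *m b)) (f - A *m (S^T *m b)) +
  lam * dot (S^T *m b) (A *m (S^T *m b)).
Proof.
pose b0 := invmx M *m (S *m (A *m f)).
pose h := S^T *m b0; pose t := S^T *m (b - b0).
have -> : Delta *m f = A *m h by rewrite /h /b0 /Defs.Delta !mulmxA.
have -> : S^T *m b = h + t by rewrite -mulmxDr addrC subrK.
have normal_eq : dot t (A *m (f - A *m h)) = lam * dot t (A *m h).
  rewrite /t !dot_mulmxl trmxK -dotZr; congr (dot _ _).
  have SAf : S *m (A *m f) = M *m b0 by rewrite /b0 mulKVmx.
  rewrite !mulmxBr SAf.
  rewrite sketchedE mulmxDl -scalemxAl !mulmxA addrAC subrr add0r.
  by rewrite /h -!mulmxA.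
have -> : f - A *m (h + t) = f - A *m h - A *m t.
  by rewrite mulmxDr opprD addrA.
move: normal_eq; move: (f - A *m h) => r normal_eq.
have hAt : dot h (A *m t) = dot t (A *m h) by rewrite dot_mulmxr A_sym dotC.
rewrite mulmxDr !dot_lin (dotC r (A *m t)) dot_mulmxl A_sym normal_eq hAt.
have := dot_ge0 (A *m t).
have := mulr_ge0 (ltW lam_gt0) (A_ge0 h).
have := mulr_ge0 (ltW lam_gt0) (A_ge0 t).
by lra.
Qed.

(** With Q the square root of A and V = Q S^T, the matrix J below is
V (V^T (A + lam) V)^-1 V^T, hence J <= (A + lam)^-1, and tr Delta = tr (J A).
A column phi of Phi has phi phi^T <= A, so that phi . J phi <= 1; there are k of
them. The remainder A - Phi Phi^T is positive semidefinite and J <= 1 / lam.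
Both bounds are extracted from J = J A J + lam J^2. *)
Lemma mxtrace_Delta_le (Q : 'M[R]_n) k (Phi : 'M[R]_(n, k)) :
  Q^T = Q -> A = Q *m Q ->
  (forall v, dot (Phi^T *m v) (Phi^T *m v) <= dot v (A *m v)) ->
  \tr Delta <= k%:R + lam^-1 * (\tr A - \tr (Phi *m Phi^T)).
Proof.
move=> Q_sym A_eq Phi_le.
have lam0 : lam != 0 by rewrite gt_eqF.
pose J := Q *m H *m Q.
have J_sym : J^T = J.
  by rewrite /J trmx_mul (trmx_mul Q) ridge_core_sym Q_sym mulmxA.
have J_eq : J *m A *m J + lam *: (J *m J) = J.
  rewrite /J -[in RHS]ridge_core_eq.
  move: (ridge_core) => N; rewrite A_eq.
  by rewrite !(mulmxDl, mulmxDr) -!(scalemxAr, scalemxAl) !mulmxA.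
have trJ : \tr Delta =
    \tr (J *m (Phi *m Phi^T)) + \tr (J *m (A - Phi *m Phi^T)).
  rewrite -linearD/= -mulmxDr addrC subrK DeltaE.
  rewrite mxtrace_mulC -[in RHS]mxtrace_mulC /J.
  move: (ridge_core) => N; rewrite A_eq.
  by rewrite !mulmxA [RHS]mxtrace_mulC !mulmxA.
move: J J_sym J_eq trJ => {}J J_sym J_eq ->.
apply: lerD.
  rewrite mulmxA mxtrace_mulC mulmxA mxtrace_dot.
  rewrite -[k in k%:R]card_ord -sumr_const; apply: ler_sum => j _.
  set e := delta_mx _ _; pose phi := Phi *m e.
  have -> : dot e (Phi^T *m J *m Phi *m e) = dot phi (J *m phi).
    by rewrite -!mulmxA dot_mulmxr trmxK.
  (* With q = phi . J phi = u . (A + lam) u one gets q^2 <= u . A u <= q. *)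
  pose u := J *m phi.
  have uE : dot phi u = dot u (A *m u) + lam * dot u u.
    rewrite {1}/u -[in LHS]J_eq mulmxDl dotDr -scalemxAl dotZr -!mulmxA.
    by rewrite !(dot_mulmxr J) J_sym.
  have : dot phi u ^+ 2 <= dot u (A *m u).
    apply: le_trans (Phi_le u); rewrite /phi dot_mulmxl.
    apply: le_trans (dot_CauchySchwarz _ _) _.
    by rewrite dot_delta mxE !eqxx mul1r.
  have := mulr_ge0 (ltW lam_gt0) (dot_ge0 u).
  by rewrite -/u; move: (dot phi u) uE => q; nra.
have A2_ge0 v : 0 <= dot v ((A - Phi *m Phi^T) *m v).
  rewrite mulmxBl dotDr dotNr subr_ge0 -mulmxA [leLHS]dot_mulmxr; exact: Phi_le.
(* L = lam L^2 + J A J shows that J <= 1 / lam. *)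
pose L := lam^-1%:M - J.
have L_sym : L^T = L by rewrite linearB/= tr_scalar_mx J_sym.
have L_eq : L = lam *: (L *m L) + J *m A *m J.
  have -> : J *m A *m J = J - lam *: (J *m J) by rewrite -{3}J_eq addrK.
  rewrite /L !(mulmxBl, mulmxBr) mul_scalar_mx mul_mx_scalar mul_scalar_mx.
  rewrite !scalerBr !scalerA mulfV// !scale1r.
  by apply/matrixP => i j; rewrite !mxE; ring.
have JE : J = lam^-1%:M - L by rewrite opprB addrC subrK.
have : 0 <= \tr (L *m (A - Phi *m Phi^T)).
  rewrite L_eq mulmxDl linearD/= -scalemxAl linearZ/= addr_ge0//.
    rewrite mulr_ge0 ?(ltW lam_gt0)// -mulmxA mxtrace_mulC mxtrace_dot.
    apply: sumr_ge0 => i _; set e := delta_mx _ _.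
    have -> : L *m (A - Phi *m Phi^T) *m L *m e =
      L *m ((A - Phi *m Phi^T) *m (L *m e)) by rewrite !mulmxA.
    by rewrite dot_mulmxr L_sym A2_ge0.
  have -> : \tr (J *m A *m J *m (A - Phi *m Phi^T)) =
      \tr ((Q *m J) *m (A - Phi *m Phi^T) *m (J *m Q)).
    by rewrite [in RHS]mxtrace_mulC [in J *m A]A_eq !mulmxA.
  rewrite mxtrace_dot; apply: sumr_ge0 => i _; set e := delta_mx _ _.
  have -> : Q *m J *m (A - Phi *m Phi^T) *m (J *m Q) *m e =
      (Q *m J) *m ((A - Phi *m Phi^T) *m (J *m Q *m e)) by rewrite !mulmxA.
  by rewrite dot_mulmxr trmx_mul J_sym Q_sym A2_ge0.
have -> : \tr (J *m (A - Phi *m Phi^T)) =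
    lam^-1 * (\tr A - \tr (Phi *m Phi^T)) -
    \tr (L *m (A - Phi *m Phi^T)).
  rewrite [in LHS]JE mulmxBl mul_scalar_mx raddfB/=; congr (_ - _).
  by rewrite mxtraceZ raddfB.
by move=> ?; rewrite gerBl.
Qed.
End sketched_ridge.

(** * Bias under a satisfiable sketch *)

Section satisfiable_sketch.
Context {R : realType}.

Lemma sum_head_tail n k (kn : (k <= n)%N) (F : 'I_n -> R) :
  \sum_i F i = \sum_j F (head_ord kn j) + \sum_j F (@tail_ord k n j).
Proof.
have e : (k + (n - k) = n)%N by rewrite subnKC.
rewrite (reindex (cast_ord e))/=; last first.
  by exists (cast_ord (esym e)) => i _; rewrite ?cast_ordK ?cast_ordKV.
by rewrite big_split_ord/=; congr (_ + _); apply: eq_bigr => j _;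
  congr F; apply: val_inj.
Qed.

Lemma nth_enum_val n (D : 'rV[R]_n) (i : 'I_n) :
  nth 0 [seq D 0 i | i <- enum 'I_n] i = D 0 i.
Proof. by rewrite (nth_map i) ?size_enum_ord// nth_ord_enum. Qed.

Lemma shat_head n (lam : R) (D : 'rV[R]_n) (j : 'I_(shat lam D)) :
  lam < D 0 (head_ord (shat_le lam D) j).
Proof.
rewrite -nth_enum_val ltNge; apply/negP => h.
by have := @before_find _ 0 (fun m => m <= lam) _ _ (ltn_ord j); rewrite h.
Qed.

Lemma shat_tail n (lam : R) (D : 'rV[R]_n) (j : 'I_(n - shat lam D)) :
  (forall i j : 'I_n, (i <= j)%N -> D 0 j <= D 0 i) ->
  D 0 (tail_ord j) <= lam.
Proof.
move=> D_noninc.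
have kn : (shat lam D < n)%N by rewrite -subn_gt0 (leq_trans _ (ltn_ord j)).
apply: (le_trans (D_noninc (Ordinal kn) _ _)); first by rewrite /= leq_addr.
rewrite -nth_enum_val/=; apply: (@nth_find _ 0 (fun m => m <= lam)).
by rewrite has_find size_map size_enum_ord.
Qed.

(** G = B^T B is within 1/2 of the identity, so it is invertible, and
|B G^-1 v|^2 = v . G^-1 v is at most 2 |v|^2. *)
Lemma near_isometry_preimage m k (B : 'M[R]_(m, k)) (v : 'cV[R]_k) :
  opnorm (B^T *m B - 1%:M) <= 2^-1 ->
  exists2 u, B^T *m u = v & dot u u <= 2 * dot v v.
Proof.
move=> Bop; pose G := B^T *m B.
have G_ge w : dot w w <= 2 * dot w (G *m w).
  have : `|dot w ((G - 1%:M) *m w)| <= 2^-1 * dot w w.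
    apply: le_trans (dot_le_l2norm _ _) _.
    rewrite -sqr_l2norm expr2 mulrCA ler_wpM2l ?l2norm_ge0//.
    apply: le_trans (le_opnorm _ _) _.
    by rewrite ler_wpM2r ?l2norm_ge0.
  by rewrite mulmxBl mul1mx !dot_lin => /ler_normlP[]; lra.
have G_unit : G \in unitmx.
  rewrite -unitmx_tr -row_free_unit -kermx_eq0; apply/eqP/row_matrixP => i.
  rewrite row0; have : row i (kermx G^T) *m G^T = 0.
    by rewrite -row_mul mulmx_ker row0.
  move=> /(congr1 trmx); rewrite trmx_mul trmxK trmx0 => G0.
  apply: trmx_inj; rewrite trmx0; apply: dot_eq0; apply/eqP.
  rewrite eq_le dot_ge0 andbT; apply: le_trans (G_ge _) _.
  by rewrite G0 /dot mulmx0 mxE mulr0.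
pose w := invmx G *m v.
have Gw : G *m w = v by rewrite /w mulKVmx.
exists (B *m w); first by rewrite mulmxA.
rewrite dot_mulmxl mulmxA -/G Gw.
have := dot_CauchySchwarz w v; have := G_ge w; rewrite Gw.
have := dot_ge0 w; have := dot_ge0 v; nra.
Qed.

Lemma dot_diag_mx n (D : 'rV[R]_n) (v w : 'cV[R]_n) :
  dot v (diag_mx D *m w) = \sum_i D 0 i * v i 0 * w i 0.
Proof.
by rewrite dotE; apply: eq_bigr => i _; rewrite mul_diag_mx mxE mulrCA mulrA.
Qed.

Section spectral.
Variables (n : nat) (A U : 'M[R]_n) (D : 'rV[R]_n).
Hypothesis AUD : is_spectral_decomposition A U D.

Lemma spectral_trmx_mul : U^T *m U = 1%:M.
Proof. by case: AUD => _ UU _ _; apply: mulmx1C. Qed.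

Lemma spectral_sym : A^T = A.
Proof. by case: AUD => -> _ _ _; rewrite !trmx_mul trmxK tr_diag_mx mulmxA. Qed.

Lemma dot_spectral v : dot v (A *m v) = \sum_i D 0 i * (U^T *m v) i 0 ^+ 2.
Proof.
case: AUD => -> _ _ _; rewrite -!mulmxA dot_mulmxr dot_diag_mx.
by apply: eq_bigr => i _; rewrite expr2 mulrA.
Qed.

Lemma spectral_ge0 v : 0 <= dot v (A *m v).
Proof.
rewrite dot_spectral sumr_ge0// => i _; rewrite mulr_ge0 ?sqr_ge0//.
by case: AUD.
Qed.

Lemma spectral_sqrt : exists2 Q : 'M[R]_n, Q^T = Q & A = Q *m Q.
Proof.
exists (U *m diag_mx (map_mx Num.sqrt D) *m U^T).
  by rewrite !trmx_mul trmxK tr_diag_mx mulmxA.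
rewrite -!mulmxA (mulmxA U^T) spectral_trmx_mul mul1mx (mulmxA (diag_mx _)).
have -> : diag_mx (map_mx Num.sqrt D) *m diag_mx (map_mx Num.sqrt D) =
    diag_mx D.
  rewrite mulmx_diag; congr diag_mx; apply/rowP => i.
  by rewrite !mxE -expr2 sqr_sqrtr//; case: AUD.
by rewrite mulmxA; case: AUD.
Qed.

(** A vector f with f f^T <= B A has coordinates z in the eigenbasis for which
z_i^2 / D_i sums to at most B, with z_i = 0 whenever D_i = 0. *)
Lemma range_sqrt_coord (f : 'cV[R]_n) (B : R) : 0 <= B ->
  (forall a, dot a f ^+ 2 <= B * dot a (A *m a)) ->
  let z := U^T *m f in
  (\sum_i z i 0 ^+ 2 / D 0 i <= B) /\
  (forall i, z i 0 ^+ 2 = D 0 i * (z i 0 ^+ 2 / D 0 i)).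
Proof.
move=> B_ge0 hf z; case: (AUD) => _ UU _ D_ge0.
have hz a : dot a z ^+ 2 <= B * \sum_i D 0 i * a i 0 ^+ 2.
  have := hf (U *m a); rewrite dot_mulmxl dot_spectral.
  by rewrite mulmxA spectral_trmx_mul mul1mx.
split; last first.
  move=> i; have [Di0|Di0] := eqVneq (D 0 i) 0; last first.
    by rewrite mulrCA mulfV// mulr1.
  rewrite Di0 mul0r; apply/eqP; rewrite eq_le sqr_ge0 andbT.
  have := hz (delta_mx i 0); rewrite dot_delta big1 ?mulr0// => j _.
  by rewrite mxE andbT; case: eqP => [->|_]; rewrite ?Di0 ?mul0r// expr0n mulr0.
set T := \sum_i _.
have T_ge0 : 0 <= T.
  by rewrite sumr_ge0// => i _; rewrite mulr_ge0 ?sqr_ge0 ?invr_ge0.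
have : T ^+ 2 <= B * T.
  have := hz (\col_i (z i 0 / D 0 i)).
  have -> : dot (\col_i (z i 0 / D 0 i)) z = T.
    by rewrite dotE; apply: eq_bigr => i _; rewrite mxE mulrAC expr2.
  congr (_ <= B * _); apply: eq_bigr => i _; rewrite mxE exprMn.
  have [->|Di0] := eqVneq (D 0 i) 0; first by rewrite invr0 mul0r mulr0.
  by field.
have [->|T0] := eqVneq T 0; last first.
  have {T0 T_ge0}T_gt0 : 0 < T by rewrite lt0r T0.
  by rewrite expr2 ler_pM2r.
by [].
Qed.

End spectral.

(** The comparison point b is chosen so that S^T b has the coordinates z_i / D_i
of A^-1 f on the leading eigenvectors: f is then fitted exactly there, and what
is left on the trailing eigenvectors is of order lam. *)
Lemma satisfiable_bias n s (A : 'M[R]_n) (S : 'M[R]_(s, n)) (lam c B : R)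
    (f : 'cV[R]_n) :
  0 < lam -> 0 < c -> 0 <= B -> sketched A lam S \in unitmx ->
  satisfiable A lam c S ->
  (forall a, dot a f ^+ 2 <= B * dot a (A *m a)) ->
  dot (f - Delta A lam S *m f) (f - Delta A lam S *m f) <=
  (3 + 6 * c ^+ 2) * (lam * B).
Proof.
move=> lam_gt0 c_gt0 B_ge0 M_unit [U [D [AUD [op1 op2]]]] hf.
have A_sym := spectral_sym AUD.
have A_ge0 := spectral_ge0 AUD.
case: (AUD) => A_eq UU D_noninc D_ge0.
have [/=] := range_sqrt_coord AUD B_ge0 hf.
have [z zE] : {z | z = U^T *m f} by exists (U^T *m f).
rewrite -zE => z_sum z_sqr.
set k := shat lam D in op1 op2.
pose kn : (k <= n)%N := shat_le lam D.
pose hd (j : 'I_k) := head_ord (shat_le lam D) j.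
pose v := \col_(j < k) (z (hd j) 0 / D 0 (hd j)).
have [b b_head b_norm] := near_isometry_preimage v op1.
pose h := U^T *m (S^T *m b).
have h_head j : h (hd j) 0 = z (hd j) 0 / D 0 (hd j).
  have := congr1 (fun m : 'cV_k => m j 0) b_head.
  rewrite [in RHS]mxE => <-.
  rewrite trmx_mul -mulmxA /h !mxE; apply: eq_bigr => i _.
  by rewrite !mxE.
apply: le_trans (ridge_optimal A_sym A_ge0 lam_gt0 M_unit f b) _.
have -> : dot (f - A *m (S^T *m b)) (f - A *m (S^T *m b)) =
    \sum_i (z i 0 - D 0 i * h i 0) ^+ 2.
  have -> : f - A *m (S^T *m b) = U *m (z - diag_mx D *m h).
    by rewrite mulmxBr zE /h !mulmxA UU mul1mx -!mulmxA A_eq !mulmxA.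
  rewrite dot_mulmxl mulmxA (spectral_trmx_mul AUD) mul1mx dotE.
  by apply: eq_bigr => i _; rewrite mul_diag_mx !mxE expr2.
rewrite (dot_spectral AUD) -/h.
(* This is where the second condition of satisfiability enters. *)
have tail_norm : \sum_j D 0 (@tail_ord k n j) * h (tail_ord j) 0 ^+ 2 <=
    (c * Num.sqrt lam) ^+ 2 * dot b b.
  rewrite (le_trans _ (dot_trmx_le b op2))// dotE.
  rewrite le_eqVlt; apply/orP; left; apply/eqP; apply: eq_bigr => j _.
  rewrite trmx_mul tr_diag_mx trmx_mul -!mulmxA mul_diag_mx !mxE.
  rewrite -expr2 exprMn sqr_sqrtr//; congr (_ * _ ^+ 2).
  by apply: eq_bigr => i _; rewrite !mxE.
have t_ge0 i : 0 <= z i 0 ^+ 2 / D 0 i by rewrite mulr_ge0 ?sqr_ge0 ?invr_ge0.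
have head_gt j : lam < D 0 (hd j) by exact: shat_head.
have v_norm : dot v v <= lam^-1 * B.
  apply: le_trans (ler_wpM2l _ z_sum); last by rewrite invr_ge0 ltW.
  rewrite (sum_head_tail kn) mulrDr -[leLHS]addr0 lerD//; last first.
    by apply: mulr_ge0; [rewrite invr_ge0 ltW|exact: sumr_ge0].
  rewrite dotE mulr_sumr ler_sum// => j _; rewrite !mxE -expr2 exprMn.
  set t := _ ^+ 2; set dj := D _ _.
  have -> : t * dj^-1 ^+ 2 = dj^-1 * (t / dj) by ring.
  apply: ler_wpM2r; first exact: t_ge0.
  rewrite lef_pV2 ?posrE ?(ltW (head_gt _))//.
  exact: lt_trans (head_gt _).
rewrite mulr_sumr -big_split/= (sum_head_tail kn)/=.
rewrite (sum_head_tail kn) in z_sum.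
set T1 := \sum_j _ in z_sum; set T2 := \sum_j _ in z_sum.
have T1_ge0 : 0 <= T1 by rewrite sumr_ge0.
have -> : \sum_j
    ((z (head_ord kn j) 0 - D 0 (head_ord kn j) * h (head_ord kn j) 0) ^+ 2 +
    lam * (D 0 (head_ord kn j) * h (head_ord kn j) 0 ^+ 2)) = lam * T1.
  rewrite mulr_sumr; apply: eq_bigr => j _.
  have -> : h (head_ord kn j) 0 = z (head_ord kn j) 0 / D 0 (head_ord kn j).
    exact: h_head.
  have : D 0 (head_ord kn j) != 0.
    by rewrite gt_eqF// (lt_trans lam_gt0)//; exact: head_gt.
  by move=> ?; field.
have tail_le : \sum_j
    ((z (@tail_ord k n j) 0 - D 0 (tail_ord j) * h (tail_ord j) 0) ^+ 2 +
    lam * (D 0 (tail_ord j) * h (tail_ord j) 0 ^+ 2)) <=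
    2 * (lam * T2) +
    3 * (lam * \sum_j D 0 (@tail_ord k n j) * h (tail_ord j) 0 ^+ 2).
  rewrite !mulr_sumr -big_split/=; apply: ler_sum => j _.
  have := shat_tail j D_noninc; have := D_ge0 (tail_ord j).
  have := t_ge0 (tail_ord j); have := z_sqr (tail_ord j).
  move: (_ / _) => t; move: (D _ _) (z _ _) (h _ _) => d y x.
  move=> yE t0 d0 dl.
  have := sqr_ge0 (y + d * x); have := ler_wpM2r t0 dl.
  have := ler_wpM2r (mulr_ge0 d0 (sqr_ge0 x)) dl.
  have -> : d * (d * x ^+ 2) = (d * x) ^+ 2 by ring.
  rewrite -yE !sqrrD sqrrN; nra.
move: tail_le tail_norm; set W := \sum_j D 0 _ * _; set V := \sum_j _.
rewrite exprMn sqr_sqrtr ?(ltW lam_gt0)// => tail_le tail_norm.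
have W_le : W <= 2 * c ^+ 2 * B.
  apply: (le_trans tail_norm).
  have -> : 2 * c ^+ 2 * B = c ^+ 2 * lam * (2 * (lam^-1 * B)).
    by field; rewrite gt_eqF.
  apply: ler_wpM2l; first by rewrite mulr_ge0 ?sqr_ge0 ?ltW.
  by apply: (le_trans b_norm); apply: ler_wpM2l.
have := ler_wpM2l (ltW lam_gt0) W_le.
have := ler_wpM2l (ltW lam_gt0) z_sum.
have := mulr_ge0 (ltW lam_gt0) T1_ge0.
have := mulr_ge0 (ltW lam_gt0) B_ge0.
by move: tail_le; rewrite mulrDr; nra.
Qed.

End satisfiable_sketch.

(** * Reproducing kernels and Mercer's expansion *)

Section reproducing_kernel.
Context {R : realType} {d : nat}.
Local Notation pt := (d.-tuple R).
Variables (X : set pt) (H : set (pt -> R)) (ip : (pt -> R) -> (pt -> R) -> R).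
Variable K : pt -> pt -> R.
Hypothesis HK : is_rkhs X H ip K.

Lemma rkhs_ip0l h : H h -> ip 0 h = 0.
Proof.
move=> Hh; have H0 := rkhs_zero HK.
by have := rkhs_ip_lin HK 1 H0 H0 Hh; rewrite scale1r addr0; lra.
Qed.

(** The discriminant argument; when ip f f = 0 the quadratic degenerates to an
affine function of t, which is bounded below only if its slope vanishes. *)
Lemma rkhs_CauchySchwarz f g : H f -> H g -> ip f g ^+ 2 <= ip f f * ip g g.
Proof.
move=> Hf Hg; have H0 := rkhs_zero HK.
have quad t : 0 <= ip g g + 2 * (t * ip g f) + t ^+ 2 * ip f f.
  have Htfg := rkhs_lin HK t Hf Hg.
  have := rkhs_ip_ge0 HK Htfg.
  rewrite (rkhs_ip_lin HK)// (rkhs_ip_sym HK Hf)// (rkhs_ip_sym HK Hg Htfg).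
  rewrite !(rkhs_ip_lin HK)// (rkhs_ip_sym HK Hf Hg).
  move=> /le_trans; apply.
  by rewrite le_eqVlt; apply/orP; left; apply/eqP; ring.
rewrite (rkhs_ip_sym HK Hf Hg).
have := rkhs_ip_ge0 HK Hf.
move: (ip g f) (ip f f) (ip g g) quad => q a b quad.
rewrite le0r => /orP[/eqP a0|a0].
  rewrite a0 mul0r; have [->|q0] := eqVneq q 0; first by rewrite expr0n.
  have := quad (- (b + 1) / (2 * q)); rewrite a0 mulr0 addr0.
  suff -> : b + 2 * (- (b + 1) / (2 * q) * q) = - 1 by lra.
  by field.
have := quad (- q / a).
have -> : b + 2 * (- q / a * q) + (- q / a) ^+ 2 * a = b - q ^+ 2 / a.
  by field; rewrite gt_eqF.
by rewrite subr_ge0 ler_pdivrMr// mulrC.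
Qed.

Lemma rkhs_kernel_comb n (xs : 'I_n -> pt) (a : 'I_n -> R) (r : seq 'I_n) :
  (forall i, X (xs i)) ->
  let g := \sum_(i <- r) a i *: (K ^~ (xs i)) in
  H g /\ forall f, H f -> ip f g = \sum_(i <- r) a i * f (xs i).
Proof.
move=> Xxs /=; elim: r => [|i r [Hg IH]].
  rewrite big_nil; split => [|f Hf]; first exact: rkhs_zero HK.
  by rewrite big_nil (rkhs_ip_sym HK)// ?rkhs_ip0l//; exact: rkhs_zero HK.
have Hi := rkhs_kernel HK (Xxs i).
have Hig := rkhs_lin HK (a i) Hi Hg.
rewrite big_cons; split=> // f Hf.
rewrite big_cons (rkhs_ip_sym HK)// (rkhs_ip_lin HK)// -IH//.
by rewrite !(rkhs_ip_sym HK _ Hf)// (rkhs_reproducing HK).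
Qed.

(** a . f is the inner product of f with sum_i a_i K(., x_i), whose squared
norm is n a . (gram a). *)
Lemma rkhs_eval_le n (xs : 'I_n -> pt) (f : pt -> R) (a : 'cV[R]_n) :
  (forall i, X (xs i)) -> H f ->
  dot a (\col_i f (xs i)) ^+ 2 <= n%:R * ip f f * dot a (gram K xs *m a).
Proof.
move=> Xxs Hf.
have [Hg ipg] := rkhs_kernel_comb (fun i => a i 0) (index_enum 'I_n) Xxs.
set g := \sum_(i <- _) _ in Hg ipg.
have -> : dot a (\col_i f (xs i)) = ip f g.
  by rewrite ipg// dotE; apply: eq_bigr => i _; rewrite mxE.
apply: le_trans (rkhs_CauchySchwarz Hf Hg) _.
rewrite -mulrA mulrCA ler_wpM2l ?(rkhs_ip_ge0 HK)// ipg// dotE.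
rewrite mulr_sumr le_eqVlt; apply/orP; left; apply/eqP; apply: eq_bigr => i _.
rewrite mulrCA; congr (_ * _); rewrite /g fct_sumE mxE mulr_sumr.
apply: eq_bigr => j _; rewrite mxE mulrA mulrA mulfV ?mul1r 1?mulrC//.
by rewrite pnatr_eq0 -lt0n (leq_ltn_trans _ (ltn_ord i)).
Qed.

End reproducing_kernel.

Section mercer.
Context {R : realType} {d : nat}.
Local Notation pt := (d.-tuple R).
Variables (X : set pt) (K : pt -> pt -> R).
Variables (mu : nat -> R) (phi : nat -> pt -> R).
Hypothesis mu_ge0 : forall i, 0 <= mu i.
Hypothesis mercer : forall x y, X x -> X y ->
  series (fun i => mu i * phi i x * phi i y) @ \oo --> K x y.

(** Phi Phi^T is the empirical kernel matrix of Mercer's expansion cut after k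
terms. *)
Definition mercer_factor n (xs : 'I_n -> pt) k : 'M[R]_(n, k) :=
  \matrix_(i, l) (Num.sqrt (n%:R^-1 * mu l) * phi l (xs i)).

Lemma mercer_factor_le n (xs : 'I_n -> pt) k (v : 'cV[R]_n) :
  (forall i, X (xs i)) ->
  dot ((mercer_factor xs k)^T *m v) ((mercer_factor xs k)^T *m v) <=
  dot v (gram K xs *m v).
Proof.
move=> Xxs.
pose u l := n%:R^-1 * mu l * (\sum_i phi l (xs i) * v i 0) ^+ 2.
have u_ge0 l : 0 <= u l by rewrite mulr_ge0 ?sqr_ge0// mulr_ge0// invr_ge0.
have -> : dot ((mercer_factor xs k)^T *m v) ((mercer_factor xs k)^T *m v) =
    series u k.
  rewrite dotE /series/= big_mkord; apply: eq_bigr => l _.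
  have -> : ((mercer_factor xs k)^T *m v) l 0 =
      Num.sqrt (n%:R^-1 * mu l) * \sum_i phi l (xs i) * v i 0.
    by rewrite mxE mulr_sumr; apply: eq_bigr => i _; rewrite !mxE mulrA.
  by rewrite -expr2 exprMn sqr_sqrtr// mulr_ge0 ?invr_ge0.
have u_cvg : series u @ \oo --> dot v (gram K xs *m v).
  have -> : series u = fun N => \sum_i \sum_j (n%:R^-1 * v i 0 * v j 0) *
      series (fun l => mu l * phi l (xs i) * phi l (xs j)) N.
    apply/funext => N; rewrite /series/=; apply: esym.
    under eq_bigr do under eq_bigr do rewrite mulr_sumr.
    under eq_bigr do rewrite exchange_big/=.
    rewrite exchange_big/=; apply: eq_bigr => l _.
    rewrite /u expr2 [in RHS]mulr_suml mulr_sumr; apply: eq_bigr => i _.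
    rewrite mulr_sumr mulr_sumr; apply: eq_bigr => j _; ring.
  have -> : dot v (gram K xs *m v) = \sum_i \sum_j (n%:R^-1 * v i 0 * v j 0) *
      K (xs i) (xs j).
    rewrite dotE; apply: eq_bigr => i _; rewrite mxE mulr_sumr.
    by apply: eq_bigr => j _; rewrite mxE; ring.
  apply: cvg_big => [|i _]; first exact: add_continuous.
  apply: cvg_big => [|j _]; first exact: add_continuous.
  by apply: cvgMl_tmp; apply: mercer.
rewrite -(cvg_lim (@Rhausdorff R) u_cvg); apply: nondecreasing_cvgn_le.
  by apply: nondecreasing_series => l _ _.
by apply/cvg_ex; eexists; exact: u_cvg.
Qed.

(** A diagonal entry of the remainder is an n-th of a tail sum of mu_i phi_i^2,
and phi_i^2 <= M^2 at every point of X. *)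
Lemma mercer_tail_le n (xs : 'I_n -> pt) k (M T : R) :
  (forall i, X (xs i)) -> (forall i x, X x -> `|phi i x| <= M) ->
  (\sum_(k <= i <oo) (mu i)%:E <= T%:E)%E ->
  \tr (gram K xs) - \tr (mercer_factor xs k *m (mercer_factor xs k)^T) <=
  M ^+ 2 * T.
Proof.
move=> Xxs phi_le T_ge.
have T_ge0 : 0 <= T.
  rewrite -lee_fin (le_trans _ T_ge)//; apply: nneseries_ge0 => i _ _.
  by rewrite lee_fin.
have point i :
    K (xs i) (xs i) - \sum_(l < k) mu l * phi l (xs i) ^+ 2 <= M ^+ 2 * T.
  set x := xs i; have Xx : X x := Xxs i.
  rewrite lerBlDr; apply: cvgr_to_le (mercer Xx Xx) _.
  exists k => // N /= kN.
  rewrite /series/= (big_cat_nat _ kN)//= addrC big_mkord.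
  apply: lerD; last by apply: ler_sum => l _; rewrite expr2 mulrA.
  have : \sum_(k <= l < N) mu l <= T.
    rewrite -lee_fin -sumEFin; apply: le_trans T_ge.
    by apply: nneseries_lim_ge => l _ _; rewrite lee_fin.
  move=> /(ler_wpM2l (sqr_ge0 M)); apply: le_trans.
  rewrite mulr_sumr; apply: ler_sum => l _; rewrite -mulrA mulrC ler_wpM2r//.
  have /ler_normlP[] := phi_le l x Xx; move: (phi l x) => y; nra.
have -> : \tr (gram K xs) - \tr (mercer_factor xs k *m (mercer_factor xs k)^T) =
    n%:R^-1 * \sum_i (K (xs i) (xs i) - \sum_(l < k) mu l * phi l (xs i) ^+ 2).
  rewrite mulr_sumr -sumrB; apply: eq_bigr => i _.
  rewrite !mxE mulrBr; congr (_ - _); rewrite mulr_sumr; apply: eq_bigr => l _.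
  by rewrite !mxE -expr2 exprMn sqr_sqrtr ?mulrA// mulr_ge0 ?invr_ge0.
apply: (@le_trans _ _ (n%:R^-1 * \sum_(i < n) M ^+ 2 * T)).
  by rewrite ler_wpM2l ?invr_ge0// ler_sum.
rewrite sumr_const card_ord -(mulr_natl (M ^+ 2 * T)) mulrA.
case: n {xs Xxs point} => [|n].
  by rewrite mulr0n invr0 !mul0r mulr_ge0 ?sqr_ge0.
by rewrite -mulrA mulKf ?pnatr_eq0.
Qed.

End mercer.

(** * Moments of the standard normal law *)

Section gaussian_moments.
Context {R : realType}.
Local Notation leb := (@lebesgue_measure R).
Local Notation psi := (normal_pdf (0 : R) 1).

(** The integral of F' over [-n, n] is F n - F (- n), of order 1 / n, and tends
to the integral over the line by dominated convergence. *)
Lemma integral_derivative_eq0 (F h : R -> R) (C : R) :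
  (forall x : R, is_derive x (1 : R) F (h x)) -> continuous h ->
  leb.-integrable setT (EFin \o h) -> (forall x, `|x| * `|F x| <= C) ->
  (\int[leb]_x (h x)%:E = 0)%E.
Proof.
move=> dF ch ih FC.
pose D n : set R := `[- n.+1%:R, n.+1%:R]%classic.
have lim1 : (\int[leb]_(x in D n) (h x)%:E)%E @[n --> \oo] -->
    (\int[leb]_x (h x)%:E)%E.
  under eq_fun do rewrite integral_mkcond.
  have mh : measurable_fun setT (EFin \o h).
    by apply/measurable_EFinP; exact: continuous_measurable_fun.
  have [] := @dominated_convergence _ _ _ leb setT measurableT
    (fun n => (EFin \o h) \_ (D n)) (EFin \o h) (fun x => `|(h x)%:E|%E) => //.
  - move=> n; apply/(measurable_restrictT _ _).1; first exact: measurable_itv.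
    exact: measurable_funTS.
  - apply/aeW => x _; apply: cvg_near_cst.
    near=> n; rewrite patchE mem_set//= /D/= in_itv/=.
    rewrite -ler_norml; apply: (@le_trans _ _ n%:R); last by rewrite ler_nat.
    by near: n; exact: nbhs_infty_ger.
  - exact: integrable_abse ih.
  - apply/aeW => x n _; rewrite patchE; case: ifPn => _ //.
    by rewrite abse0.
have val n : (\int[leb]_(x in D n) (h x)%:E = (F n.+1%:R - F (- n.+1%:R))%:E)%E.
  have n0 : (0 : R) < n.+1%:R by rewrite ltr0n.
  have cF x : {for x, continuous F}.
    apply: differentiable_continuous.
    by apply/derivable1_diffP; exact: ex_derive.
  rewrite EFinB; apply: continuous_FTC2.
  - lra.
  - exact: continuous_subspaceT.
  - split.
    + by move=> x _; exact: ex_derive.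
    + by apply: cvg_at_right_filter; exact: cF.
    + by apply: cvg_at_left_filter; exact: cF.
  - by move=> x _; rewrite derive1E derive_val.
have lim0 : (\int[leb]_(x in D n) (h x)%:E)%E @[n --> \oo] --> (0%:E)%E.
  under eq_fun do rewrite val.
  apply: cvg_EFin; first by near=> n.
  apply: norm_cvg0 => /=.
  apply: (@squeeze_cvgr _ _ _ _ (cst 0) (fun n => (2 * C) * n.+1%:R^-1)).
  - near=> n; rewrite normr_ge0/= ler_pdivlMr ?ltr0n// mulrC.
    apply: le_trans (ler_wpM2l _ (ler_normB _ _)) _; first by [].
    have := FC n.+1%:R; have := FC (- n.+1%:R).
    by rewrite normrN ger0_norm//; lra.
  - exact: cvg_cst.
  - rewrite -[X in _ --> X](mulr0 (2 * C)); apply: cvgMl_tmp.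
    exact: cvg_harmonic.
exact: (cvg_unique _ lim1 lim0).
Unshelve. all: by end_near. Qed.

Lemma std_normal_pdfE x : psi x = normal_peak 1 * expR (- (x ^+ 2 / 2)).
Proof.
rewrite normal_pdfE ?oner_neq0// /normal_fun subr0 expr1n.
by rewrite mulNr -[1 *+ 2]/(2 : R).
Qed.

(** Any polynomial of degree at most 4 times the density of N(0,1) is dominated
by a multiple of the density of N(0,4), because 1 + x^4 <= 30 exp (3 x^2 / 8). *)
Lemma std_normal_pdf_quartic x : (1 + x ^+ 4) * psi x <=
  30 * normal_peak 1 / normal_peak 2 * normal_pdf 0 2 x.
Proof.
have p2 : (2 : R) != 0 by rewrite pnatr_eq0.
rewrite std_normal_pdfE normal_pdfE// /normal_fun subr0 mulrA divfK; last first.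
  by rewrite gt_eqF// normal_peak_gt0.
rewrite mulrCA -mulrA [leRHS]mulrCA ler_wpM2l ?normal_peak_ge0//.
(* The exponent 3 x^2 / 8 is split in two so that the square of the linear
   lower bound of exp yields a term in x^4. *)
have -> : - x ^+ 2 / (2 ^+ 2 *+ 2) =
    - (x ^+ 2 / 2) + (3 * x ^+ 2 / 16) + (3 * x ^+ 2 / 16).
  by field.
have := expR_ge1Dx (3 * x ^+ 2 / 16); have := sqr_ge0 x.
rewrite !expRD; move: (expR (3 * _ / _)) => e.
move=> y0 ye; rewrite -!(mulrA (expR _)) [leLHS]mulrC [leRHS]mulrCA.
rewrite ler_wpM2l ?expR_ge0//.
move: y0 ye.
have -> : x ^+ 4 = (x ^+ 2) ^+ 2 by ring.
move: (x ^+ 2) => y y0 ye.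
have : (1 + 3 * y / 16) * (1 + 3 * y / 16) <= e * e by apply: ler_pM; lra.
by nra.
Qed.

Lemma horner_le_quartic (q : {poly R}) x : (size q <= 5)%N ->
  `|q.[x]| <= (\sum_(i < 5) `|q`_i|) * (1 + x ^+ 4).
Proof.
move=> q5; rewrite (horner_coef_wide _ q5) mulr_suml.
apply: le_trans (ler_norm_sum _ _ _) _; apply: ler_sum => i _.
rewrite normrM ler_wpM2l// normrX.
have -> : x ^+ 4 = `|x| ^+ 4 by rewrite -normrX ger0_norm// exprn_even_ge0.
have := normr_ge0 x; move: `|x| => y y0.
have y4 : 0 <= y ^+ 4 by rewrite exprn_ge0.
have [y1|y1] := leP y 1.
  by apply: (@le_trans _ _ 1); [rewrite exprn_ile1|lra].
apply: (@le_trans _ _ (y ^+ 4)); last lra.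
by rewrite ler_weXn2l ?ltW// -ltnS.
Qed.

Lemma integrable_poly_normal (q : {poly R}) : (size q <= 5)%N ->
  leb.-integrable setT (fun x => (q.[x] * psi x)%:E).
Proof.
move=> q5; set K := \sum_(i < 5) `|q`_i|.
pose B := K * (30 * normal_peak 1 / normal_peak 2).
apply: (@le_integrable _ _ _ leb setT measurableT _
  (fun x => B%:E * (normal_pdf 0 2 x)%:E)%E).
- apply/measurable_EFinP.
  apply: measurable_funM; last exact: measurable_normal_pdf.
  by apply: continuous_measurable_fun; exact: continuous_horner.
- move=> x _; rewrite -EFinM !abse_EFin lee_fin [leLHS]normrM.
  rewrite (ger0_norm (normal_pdf_ge0 _ _ _)).
  apply: (le_trans _ (ler_norm _)).
  apply: le_trans (ler_wpM2r (normal_pdf_ge0 _ _ _) (horner_le_quartic x q5)) _.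
  rewrite /B -!mulrA ler_wpM2l ?sumr_ge0//.
  have := std_normal_pdf_quartic x; rewrite -!mulrA; exact.
- apply: integrableZl => //; exact: integrable_normal_pdf.
Qed.

(** Gaussian integration by parts: - q psi is an antiderivative. *)
Lemma integral_stein (q : {poly R}) : (size q <= 4)%N ->
  (\int[leb]_x (('X * q - q^`()).[x] * psi x)%:E = 0)%E.
Proof.
move=> q4.
have Xq5 : (size ('X * q)%R <= 5)%N.
  by apply: leq_trans (size_polyMleq _ _) _; rewrite size_polyX.
have Xqq5 : (size ('X * q - q^`())%R <= 5)%N.
  rewrite (leq_trans (size_polyD _ _))// size_polyN geq_max Xq5/=.
  rewrite (leq_trans (size_poly _ _))// (leq_trans (leq_pred _))//.
  by rewrite (leq_trans q4).
pose K := \sum_(i < 5) `|('X * q)`_i|.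
apply: (@integral_derivative_eq0 (fun x => - (q.[x] * psi x)) _
  (K * (30 * normal_peak 1 / normal_peak 2 * normal_peak 2))).
- move=> x.
  have dpsi : is_derive (x : R) (1 : R) psi (- x * psi x).
    have -> : psi = normal_peak 1 \*: (expR \o horner (- 2^-1 *: 'X^2)).
      apply/funext => t; rewrite std_normal_pdfE.
      transitivity (normal_peak 1 * expR (- 2^-1 *: 'X^2).[t]) => //.
      by rewrite hornerZ hornerXn; congr (_ * expR _); ring.
    apply: (is_derive_eq (is_deriveZ _
      (is_derive1_comp (is_derive_expR _) (is_derive_poly _ _)))).
    rewrite -[LHS]/(normal_peak 1 *
      (expR (- 2^-1 *: 'X^2).[x] * (- 2^-1 *: 'X^2)^`().[x])).
    rewrite -[RHS]/(- x * (normal_peak 1 * expR (- 2^-1 *: 'X^2).[x])).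
    move: (expR _) => e; rewrite derivZ derivXn hornerZ hornerMn hornerXn/=.
    by field.
  apply: (is_derive_eq (is_deriveN (is_deriveM (is_derive_poly q x) dpsi))).
  by rewrite !hornerE /GRing.scale/=; ring.
- move=> x; apply: cvgM; first exact: continuous_horner.
  by apply: continuous_normal_pdf; exact: oner_neq0.
- exact: integrable_poly_normal.
- move=> x; rewrite normrN normrM mulrA -normrM.
  have -> : x * q.[x] = ('X * q).[x] by rewrite hornerM hornerX.
  rewrite (ger0_norm (normal_pdf_ge0 _ _ _)).
  apply: le_trans
    (ler_wpM2r (normal_pdf_ge0 _ _ _) (horner_le_quartic x Xq5)) _.
  rewrite -[leLHS]mulrA; apply: ler_wpM2l; first exact: sumr_ge0.
  apply: le_trans (std_normal_pdf_quartic x) _; apply: ler_wpM2l.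
    by rewrite mulr_ge0 ?invr_ge0 ?normal_peak_ge0// mulr_ge0 ?normal_peak_ge0.
  by apply: normal_pdf_ub; rewrite pnatr_eq0.
Qed.

(** The density of N(0,1) is almost everywhere equal to the Radon-Nikodym
derivative, for which the change of variables is known. *)
Lemma integral_normal_density (f : R -> R) :
  measurable_fun setT f -> (forall x, 0 <= f x) ->
  (\int[normal_prob 0 1]_x (f x)%:E = \int[leb]_x (f x * psi x)%:E)%E.
Proof.
move=> mf f_ge0.
have dom := @normal_prob_dominates R 0 1.
have mpsi : measurable_fun setT (EFin \o psi).
  by apply/measurable_EFinP; exact: measurable_normal_pdf.
have mEf : measurable_fun setT (EFin \o f) by exact/measurable_EFinP.
rewrite -(Radon_Nikodym_SigmaFinite.change_of_variables dom)//.
have int_RN := Radon_Nikodym_SigmaFinite.f_integrable dom.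
under [RHS]eq_integral do rewrite EFinM.
apply: ae_eq_integral => //.
- by apply: emeasurable_funM => //; exact: measurable_int int_RN.
- exact: emeasurable_funM.
- apply: ae_eqe_mul2l; apply: integral_ae_eq => //.
  by move=> E _ mE; rewrite -(Radon_Nikodym_SigmaFinite.f_integral dom).
Qed.

(** Stein's identity applied to q = k1 + k2 x + k3 (x^2 + 2) + k4 (x^3 + 3 x),
for which x q - q' = k1 x + k2 (x^2 - 1) + k3 x^3 + k4 (x^4 - 3). *)
Lemma integral_quartic_normal (k0 k1 k2 k3 k4 : R) (f : R -> R) :
  (forall x, f x = k0 + k1 * x + k2 * x ^+ 2 + k3 * x ^+ 3 + k4 * x ^+ 4) ->
  (forall x, 0 <= f x) ->
  (\int[normal_prob 0 1]_x (f x)%:E = (k0 + k2 + 3 * k4)%:E)%E.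
Proof.
move=> fE f_ge0.
pose q : {poly R} := Poly [:: k1 + 2 * k3; k2 + 3 * k4; k3; k4].
have q4 : (size q <= 4)%N by exact: size_Poly.
have qE x : ('X * q - q^`()).[x] = f x - (k0 + k2 + 3 * k4).
  rewrite fE /q hornerD hornerN hornerM hornerX.
  rewrite [Poly _]/= !cons_poly_def !poly.derivE !hornerE/=; ring.
pose P : {poly R} := Poly [:: k0; k1; k2; k3; k4].
have fP : f = horner P.
  apply/funext => x.
  by rewrite fE /P [Poly _]/= !cons_poly_def !hornerE/=; ring.
have mf : measurable_fun setT f.
  by rewrite fP; apply: continuous_measurable_fun; exact: continuous_horner.
have int_psi : leb.-integrable setT (fun x => ((k0 + k2 + 3 * k4) * psi x)%:E).
  under eq_fun do rewrite EFinM.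
  by apply: integrableZl => //; exact: integrable_normal_pdf.
have int_f : leb.-integrable setT (fun x => (f x * psi x)%:E).
  by rewrite fP; apply: integrable_poly_normal; exact: size_Poly.
have := integral_stein q4.
under eq_integral do rewrite qE mulrBl EFinB.
rewrite integralB// -integral_normal_density//.
under [X in (_ - X)%E]eq_integral do rewrite EFinM.
rewrite integralZl//; last exact: integrable_normal_pdf.
rewrite integral_normal_pdf mule1 => /eqP.
rewrite sube_eq ?add0e// => [/eqP//|].
rewrite integral_normal_density//.
exact: integrable_fin_num int_f.
Qed.

End gaussian_moments.

(** * Quadratic forms in independent standard normal variables *)

Section gaussian_tuple.
Context {R : realType}.

(** The subtracted trace centers the quadratic part for a law with mean 0 and
identity covariance. *)
Definition quad_form n (b : 'I_n -> 'I_n -> R) (a : 'I_n -> R) (c : R)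
    (t : n.-tuple R) : R :=
  c + (\sum_i \sum_j b i j * tnth t i * tnth t j - \sum_i b i i) +
  \sum_i a i * tnth t i.

Lemma measurable_quad_form n b a c : measurable_fun setT (@quad_form n b a c).
Proof.
have mt := @measurable_tnth _ R n.
apply: measurable_funD; first apply: measurable_funD => //.
  apply: measurable_funB => //; apply: measurable_sum => i.
  apply: measurable_sum => j; apply: measurable_funM => //.
  exact: measurable_funM.
by apply: measurable_sum => i; exact: measurable_funM.
Qed.

Lemma quad_form_cons n (b : 'I_n.+1 -> 'I_n.+1 -> R) a c x (t : n.-tuple R) :
  (forall i j, b i j = b j i) ->
  quad_form b a c [tuple of x :: t] =
  quad_form (fun i j => b (lift ord0 i) (lift ord0 j))
    (fun j => 2 * b ord0 (lift ord0 j) * x + a (lift ord0 j))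
    (c + b ord0 ord0 * (x ^+ 2 - 1) + a ord0 * x) t.
Proof.
move=> b_sym; rewrite /quad_form !big_ord_recl !tnth0.
under eq_bigr do rewrite tnthS mulrAC.
under [X in _ + X - _]eq_bigr do rewrite big_ord_recl tnth0 tnthS.
under [X in _ + X - _]eq_bigr do under eq_bigr do rewrite tnthS.
under [X in _ + (_ + X) = _]eq_bigr do rewrite tnthS.
rewrite big_split/=.
under [X in _ = _ + X]eq_bigr do rewrite mulrDl.
rewrite big_split/=.
have -> : \sum_(i < n) b (lift ord0 i) ord0 * tnth t i * x =
    \sum_(i < n) b ord0 (lift ord0 i) * tnth t i * x.
  by apply: eq_bigr => i _; rewrite b_sym.
have -> : \sum_(i < n) 2 * b ord0 (lift ord0 i) * x * tnth t i =
    2 * \sum_(i < n) b ord0 (lift ord0 i) * tnth t i * x.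
  by rewrite mulr_sumr; apply: eq_bigr => i _; ring.
ring.
Qed.

Lemma measurable_box n (q : 'I_n -> R) :
  measurable [set t : n.-tuple R | forall i, tnth t i <= q i].
Proof.
have -> : [set t : n.-tuple R | forall i, tnth t i <= q i] =
    \bigcap_(i in [set: 'I_n]) ((fun t => tnth t i) @^-1` `]-oo, q i]).
  apply/seteqP; split => [t/= h i _/=|t/= h i]; first by rewrite in_itv/=.
  by have := h i I; rewrite /= in_itv.
apply: fin_bigcap_measurable => // i _; rewrite -[X in measurable X]setTI.
exact: measurable_tnth.
Qed.

Definition gaussian_quad_moments n (Q : probability (n.-tuple R) R) : Prop :=
  forall b a c, (forall i j, b i j = b j i) ->
    (\int[Q]_t ((quad_form b a c t) ^+ 2)%:E =
     (c ^+ 2 + 2 * \sum_i \sum_j b i j ^+ 2 + \sum_i a i ^+ 2)%:E)%E.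

(** The law N(0,1)^n is obtained by adding one coordinate at a time. The second
moment of a quadratic form then follows by induction: with the first coordinate
x frozen, Tonelli's theorem leaves a quadratic form of the same shape in the
other coordinates, whose constant and linear coefficients are polynomials in x.
Carrying the constant c along makes every integrand nonnegative, so that no
integrability has to be checked on the way. *)
Lemma exists_gaussian_tuple n : exists2 Q : probability (n.-tuple R) R,
  (forall q : 'I_n -> R, Q [set t | forall i, tnth t i <= q i] =
     (\prod_i normal_prob 0 1 `]-oo, q i])%E) &
  gaussian_quad_moments Q.
Proof.
elim: n => [|n [Q Qbox Qint]].
  exists (dirac ([tuple] : 0.-tuple R)) => [q|b a c _].
    rewrite big_ord0 (_ : [set t | _] = setT); first exact: probability_setT.
    by apply/seteqP; split => // t _ [].
  rewrite integral_dirac//=.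
    by rewrite diracT mul1e /quad_form !big_ord0 mulr0 !subr0 !addr0.
  apply/measurable_EFinP; apply: measurable_funX; exact: measurable_quad_form.
pose T := (measurableTypeR R * n.-tuple R)%type.
pose cons (p : T) : n.+1.-tuple R := [tuple of p.1 :: p.2].
have mcons : measurable_fun setT cons.
  by apply: measurable_cons; [exact: measurable_fst|exact: measurable_snd].
pose X : {mfun T >-> n.+1.-tuple R} :=
  HB.pack cons (isMeasurableFun.Build _ _ _ _ cons mcons).
exists (distribution (normal_prob 0 1 \x Q)%E X).
- move=> q.
  have preE : cons @^-1` [set t | forall i, tnth t i <= q i] =
     `]-oo, q ord0]%classic `*` [set t | forall i, tnth t i <= q (lift ord0 i)].
    apply/seteqP; split => -[x t]/= h.
      split; first by have := h ord0; rewrite in_itv/= tnth0.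
      by move=> i; have := h (lift ord0 i); rewrite tnthS.
    case: h => h0 h i; case: (unliftP ord0 i) => [j|] ->.
      by rewrite tnthS; exact: h.
    by rewrite tnth0; move: h0; rewrite in_itv.
  rewrite -[LHS]/((normal_prob 0 1 \x Q)%E (cons @^-1` _)) preE.
  rewrite product_measure1E//; last exact: measurable_box.
  by rewrite big_ord_recl; congr (_ * _)%E; exact: Qbox.
- move=> b a c b_sym.
  pose f t := ((quad_form b a c t) ^+ 2)%:E.
  have mf : measurable_fun setT f.
    apply/measurable_EFinP; apply: measurable_funX.
    exact: measurable_quad_form.
  rewrite ge0_integral_pushforward//; last first.
    by move=> t _; rewrite lee_fin sqr_ge0.
  rewrite preimage_setT fubini_tonelli1//=; last 2 first.
  + exact: measurableT_comp.
  + by move=> t; rewrite lee_fin sqr_ge0.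
  pose b0 j := b ord0 (lift ord0 j); pose a' j := a (lift ord0 j).
  pose N2 := \sum_i \sum_j b (lift ord0 i) (lift ord0 j) ^+ 2.
  pose g x := (c + b ord0 ord0 * (x ^+ 2 - 1) + a ord0 * x) ^+ 2 + 2 * N2 +
    \sum_j (2 * b0 j * x + a' j) ^+ 2.
  transitivity (\int[normal_prob 0 1]_x (g x)%:E)%E.
    apply: eq_integral => x _.
    rewrite -Qint; last by move=> i j; rewrite b_sym.
    by apply: eq_integral => t _; rewrite /f /= quad_form_cons.
  pose S0 := \sum_j b0 j ^+ 2; pose S1 := \sum_j b0 j * a' j.
  pose S2 := \sum_j a' j ^+ 2.
  have gE x : g x =
      (c + b ord0 ord0 * (x ^+ 2 - 1) + a ord0 * x) ^+ 2 + 2 * N2 +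
      (4 * S0 * x ^+ 2 + 4 * S1 * x + S2).
    congr (_ + _); rewrite /S0 /S1 /S2 !(mulr_sumr, mulr_suml) -!big_split/=.
    by apply: eq_bigr => j _; ring.
  have N2_ge0 : 0 <= N2.
    by apply: sumr_ge0 => i _; apply: sumr_ge0 => j _; exact: sqr_ge0.
  rewrite (@integral_quartic_normal R
    ((c - b ord0 ord0) ^+ 2 + 2 * N2 + S2)
    (2 * a ord0 * (c - b ord0 ord0) + 4 * S1)
    (a ord0 ^+ 2 + 2 * b ord0 ord0 * (c - b ord0 ord0) + 4 * S0)
    (2 * a ord0 * b ord0 ord0) (b ord0 ord0 ^+ 2)).
  + congr _%:E; rewrite !big_ord_recl -/S2.
    under [X in 2 * (_ + X)]eq_bigr do rewrite big_ord_recl b_sym.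
    by rewrite big_split/= -/S0 -/N2; ring.
  + by move=> x; rewrite gE; ring.
  + move=> x; rewrite !addr_ge0 ?sqr_ge0 ?mulr_ge0// sumr_ge0// => j _.
    exact: sqr_ge0.
Qed.

End gaussian_tuple.

(** * The conditional law of the noise *)

Section orthants.
Context {R : realType}.

(** Orthants with rational corners: a countable family, stable under
intersection, that generates the Borel sets of R^n. *)
Definition rat_orthant n (q : {ffun 'I_n -> rat}) : set (n.-tuple R) :=
  [set t | forall i, tnth t i <= ratr (q i)].

Lemma measurable_rat_orthant n (q : {ffun 'I_n -> rat}) :
  measurable (rat_orthant q).
Proof. exact: (measurable_box (fun i => ratr (q i))). Qed.

Lemma rat_orthantI n (q r : {ffun 'I_n -> rat}) :
  rat_orthant q `&` rat_orthant r =
  rat_orthant [ffun i => Order.min (q i) (r i)].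
Proof.
apply/seteqP; split => t /=.
  move=> [tq tr] i; rewrite ffunE /Order.min; case: ifP => _.
    exact: tq.
  exact: tr.
move=> h; split => i; apply: (le_trans (h i)); rewrite ffunE ler_rat.
  by rewrite ge_min lexx.
by rewrite ge_min lexx orbT.
Qed.

(** Letting the coordinates outside P go to infinity. Both extreme cases are
needed: a single constrained coordinate gives half-spaces, and none at all gives
a countable cover of R^n. *)
Lemma bigcup_rat_orthant n (P : pred 'I_n) (q : rat) :
  \bigcup_k rat_orthant [ffun i : 'I_n => if P i then q else k%:R] =
  [set t : n.-tuple R | forall i, P i -> tnth t i <= ratr q].
Proof.
apply/seteqP; split => t /=.
  by move=> [k _] h i Pi; have := h i; rewrite ffunE Pi.
move=> h; pose k := (Num.truncn (\sum_i `|tnth t i|)).+1.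
exists k => // i; rewrite ffunE; case: ifP => [/h//|_].
rewrite ratr_nat (le_trans (ler_norm _))//.
apply: (@le_trans _ _ (\sum_i `|tnth t i|)).
  by rewrite (bigD1 i)//= lerDl sumr_ge0.
by apply: ltW; apply: truncnS_gt.
Qed.

Lemma measurable_tuple_rat_orthant n :
  @measurable _ (n.-tuple R) = <<s range (@rat_orthant n) >>.
Proof.
apply/seteqP; split; last first.
  apply: smallest_sub; first exact: sigma_algebra_measurable.
  by move=> _ [q _ <-]; exact: measurable_rat_orthant.
pose T := g_sigma_algebraType (range (@rat_orthant n)).
have mq (q : {ffun 'I_n -> rat}) : @measurable _ T (rat_orthant q).
  by apply: sub_sigma_algebra; exists q.
have mcoord i : measurable_fun setT (fun t : T => tnth t i).
  have RG : @measurable _ R = <<s @RGenOInfty.G R >>.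
    exact: RGenOInfty.measurableE.
  apply: (@measurability _ _ T R setT (fun t : T => tnth t i) _ RG).
  move=> _ [_ [x ->] <-].
  have -> : setT `&` (fun t : T => tnth t i) @^-1` `]x, +oo[ =
     \bigcup_(q in [set q : rat | x <= ratr q])
       ~` [set t : T | forall j, pred1 i j -> tnth t j <= ratr q].
    apply/seteqP; split => t /=.
      rewrite in_itv/= andbT => -[_ /rat_in_itvoo[q]].
      rewrite in_itv/= => /andP[xq qt]; exists q; first exact: ltW.
      by move=> /(_ i (eqxx _)); rewrite leNgt qt.
    move=> [q xq h]; split=> //; rewrite in_itv/= andbT ltNge; apply/negP => tx.
    by apply: h => j /eqP ->; exact: le_trans xq.
  have -> : \bigcup_(q in [set q : rat | x <= ratr q])
       ~` [set t : T | forall j, pred1 i j -> tnth t j <= ratr q] =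
    \bigcup_(q : rat) if x <= ratr q then
       ~` [set t : T | forall j, pred1 i j -> tnth t j <= ratr q] else set0.
    rewrite bigcup_mkcond; apply: eq_bigcupr => q _.
    by congr (if _ then _ else _); apply/idP/idP; rewrite inE.
  apply: bigcupT_measurable_rat => q; case: ifP => // _.
  apply: measurableC; rewrite -bigcup_rat_orthant.
  by apply: bigcupT_measurable => k; exact: mq.
have mid : measurable_fun [set: T] (fun t : T => t : n.-tuple R).
  by apply/measurable_fun_tnthP => i; exact: mcoord.
by move=> A mA; rewrite -[A]setTI; exact: mid.
Qed.

Lemma tuple_law_unique n (Q1 Q2 : probability (n.-tuple R) R) :
  (forall q, Q1 (@rat_orthant n q) = Q2 (@rat_orthant n q)) ->
  forall A, measurable A -> Q1 A = Q2 A.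
Proof.
move=> Q12; apply: (@measure_unique _ R _ (range (@rat_orthant n))
  (fun k => @rat_orthant n [ffun i => if pred0 i then 0 else k%:R])).
- exact: measurable_tuple_rat_orthant.
- move=> _ _ [q _ <-] [r _ <-]; rewrite rat_orthantI.
  by exists [ffun i => Order.min (q i) (r i)].
- by move=> k; exists [ffun i => if pred0 i then 0 else k%:R].
- by rewrite (bigcup_rat_orthant pred0 0); apply/seteqP; split.
- by move=> _ [q _ <-]; exact: Q12.
- by move=> k; rewrite (le_lt_trans (probability_le1 _ _)) ?ltry//;
    exact: measurable_rat_orthant.
Qed.

End orthants.

Section conditional_law.
Context {R : realType} {dO : measure_display} {Omega : measurableType dO}.
Variable P : probability Omega R.

(** The sets where a version of P(E | G) is above, or below, the constant P(E)
belong to G, and independence forces the integral of the difference over each of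
them to vanish. *)
Lemma cond_prob_independent (G : set (set Omega)) (E : set Omega)
    (g : Omega -> \bar R) :
  G `<=` measurable -> measurable E -> is_cond_prob P G E g ->
  (forall A, G A -> P (E `&` A) = (P E * P A)%E) ->
  {ae P, forall w, g w = P E}.
Proof.
move=> Gm mE [gG gi gint] indep.
have mg := measurable_int _ gi.
have PE_fin : P E \is a fin_num by exact: fin_num_measure.
have cst_int A : measurable A -> P.-integrable A (cst (P E)).
  by move=> mA; rewrite -(fineK PE_fin); exact: finite_measure_integrable_cst.
have mh : measurable_fun setT (fun w => g w - P E)%E.
  by apply: emeasurable_funB => //; exact: measurable_cst.
have key (A : set Omega) : G A ->
    (forall w, A w -> (0 <= g w - P E)%E) \/
    (forall w, A w -> (g w - P E <= 0)%E) ->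
    {ae P, forall w, A w -> (g w - P E = 0)%E}.
  move=> GA sgn; have mA := Gm _ GA.
  have hi : P.-integrable A (fun w => g w - P E)%E.
    by apply: integrableB => //; [exact: integrableS gi|exact: cst_int].
  have int0 : (\int[P]_(w in A) (g w - P E) = 0)%E.
    rewrite integralB//; last 2 first.
    - exact: integrableS gi.
    - exact: cst_int.
    by rewrite gint// indep// integral_cst// subee// fin_numM// fin_num_measure.
  have mhA : measurable_fun A (fun w => g w - P E)%E by exact: measurable_funTS.
  apply/(ae_eq_integral_abs _ mA mhA).1; case: sgn => sgn.
    by rewrite -[RHS]int0; apply: eq_integral => w /[!inE] /sgn /gee0_abs.
  transitivity (\int[P]_(w in A) - (g w - P E))%E.
    by apply: eq_integral => w /[!inE] /sgn /lee0_abs.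
  by rewrite integralN ?int0 ?oppe0//; exact: integrable_add_def.
have ge_ae : {ae P, forall w, (P E <= g w -> g w - P E = 0)%E}.
  have : {ae P, forall w, (g @^-1` `[P E, +oo[) w -> (g w - P E = 0)%E}.
    apply: key; first by apply: gG; exact: emeasurable_itv.
    by left => w; rewrite /= in_itv/= andbT sube_ge0 ?PE_fin ?orbT.
  by apply: filterS => w /= h Ew; apply: h; rewrite in_itv/= Ew.
have le_ae : {ae P, forall w, (g w <= P E -> g w - P E = 0)%E}.
  have : {ae P, forall w, (g @^-1` `]-oo, P E]) w -> (g w - P E = 0)%E}.
    apply: key; first by apply: gG; exact: emeasurable_itv.
    by right => w; rewrite /= in_itv/= sube_le0.
  by apply: filterS => w /= h Ew; apply: h; rewrite in_itv.
apply: filterS2 ge_ae le_ae => w ge_w le_w; rewrite -[LHS](subeK _ PE_fin).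
by case/orP: (le_total (g w) (P E)) => [/le_w|/ge_w] ->; rewrite add0e.
Qed.

End conditional_law.

Section noise_law.
Context {R : realType} {d : nat} {dO : measure_display}
  {Omega : measurableType dO} (P : probability Omega R).
Local Notation pt := (d.-tuple R).
Variables (x : nat -> {RV P >-> pt}) (noise : nat -> {RV P >-> R})
  (s : nat -> nat) (S : forall n, Omega -> 'M[R]_(s n, n)).
Variables (X : set pt) (PX : probability pt R).
Hypothesis M : is_model x noise S X PX.

Lemma sigma_x_measurable n : sigma_x x n `<=` measurable.
Proof.
apply: smallest_sub; first exact: sigma_algebra_measurable.
move=> A [i _ [B mB <-]]; exact: (measurable_funP (x i)).
Qed.

Lemma sigma_xS_measurable n : sigma_xS x S n `<=` measurable.
Proof.
apply: smallest_sub; first exact: sigma_algebra_measurable.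
rewrite subUset; split; first exact: sigma_x_measurable.
apply: smallest_sub; first exact: sigma_algebra_measurable.
move=> A [[i j] _ [B mB <-]].
by apply: (model_S_meas M i j).
Qed.

Lemma noise_orthantE n (q : {ffun 'I_n -> rat}) :
  noise_tuple noise n @^-1` rat_orthant q =
  \bigcap_(i in [set: 'I_n]) (noise i @^-1` `]-oo, ratr (q i)]).
Proof.
apply/seteqP; split => w /=.
  by move=> h i _; have := h i; rewrite tnth_mktuple /= in_itv.
by move=> h i; have := h i I; rewrite tnth_mktuple /= in_itv.
Qed.

Lemma noise_orthant_sigma n (q : {ffun 'I_n -> rat}) :
  sigma_noise noise n (noise_tuple noise n @^-1` rat_orthant q).
Proof.
rewrite noise_orthantE.
apply: (@fin_bigcap_measurable _ (g_sigma_algebraType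
  (\bigcup_(i in `I_n) preimage_set_system setT (noise i) measurable))).
  by [].
move=> i _.
apply: sub_sigma_algebra; exists i => /=; first exact: ltn_ord.
by exists `]-oo, ratr (q i)]%classic => //; rewrite setTI.
Qed.

Lemma noise_orthant_prob n (q : {ffun 'I_n -> rat}) :
  P (noise_tuple noise n @^-1` rat_orthant q) =
  (\prod_i normal_prob 0 1 `]-oo, ratr (q i)])%E.
Proof.
case: (model_noise_iid M) => indep law.
pose B k := if insub k is Some i then `]-oo, ratr (q i)]%classic else [set: R].
have BE (i : 'I_n) : B i = `]-oo, ratr (q i)]%classic by rewrite /B valK.
have mB k : measurable (B k) by rewrite /B; case: insubP.
pose J := seq_fset tt (iota 0 n).
have := indep J B mB.
have -> : \bigcap_(i in [set` J]) (noise i @^-1` B i) =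
    noise_tuple noise n @^-1` rat_orthant q.
  rewrite noise_orthantE; apply/seteqP; split => w h.
    move=> i _; have := h i; rewrite BE; apply => /=.
    by rewrite seq_fsetE mem_iota /= ltn_ord.
  move=> k /=; rewrite seq_fsetE mem_iota /= add0n => kn.
  by have := h (Ordinal kn) I; rewrite -BE.
move=> ->.
rewrite (perm_big _ (seq_fset_perm tt (iota 0 n))) undup_id ?iota_uniq//=.
have -> : iota 0 n = index_iota 0 n by rewrite /index_iota subn0.
rewrite big_mkord; apply: eq_bigr => i _.
by rewrite BE; apply: law.
Qed.

(** The conditional probability of each rational orthant is almost surely
constant by independence, and the countably many null sets are discarded. *)
Lemma kernel_ae_gaussian n (kap : Omega -> probability (n.-tuple R) R)
    (Q : probability (n.-tuple R) R) :
  is_regular_cond_dist P (sigma_xS x S n) (noise_tuple noise n) kap ->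
  (forall q : 'I_n -> R, Q [set t | forall i, tnth t i <= q i] =
     (\prod_i normal_prob 0 1 `]-oo, q i])%E) ->
  {ae P, forall w A, measurable A -> kap w A = Q A}.
Proof.
move=> kapP Qbox.
have ae_q (q : {ffun 'I_n -> rat}) :
    {ae P, forall w, kap w (rat_orthant q) = Q (rat_orthant q)}.
  have -> : Q (rat_orthant q) = P (noise_tuple noise n @^-1` rat_orthant q).
    by rewrite noise_orthant_prob; exact: Qbox.
  have mE : measurable (noise_tuple noise n @^-1` rat_orthant q).
    rewrite noise_orthantE; apply: fin_bigcap_measurable => // i _.
    by rewrite -[X in measurable X]setTI; exact: (measurable_funP (noise i)).
  apply: (cond_prob_independent (@sigma_xS_measurable n) mE
    (kapP _ (measurable_rat_orthant q))).
  move=> A GA; exact: (model_indep M (noise_orthant_sigma q) GA).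
have : {ae P, forall w k,
    if (choice.unpickle k : option {ffun 'I_n -> rat}) is Some q then
    kap w (@rat_orthant R n q) = Q (rat_orthant q) else True}.
  apply: ae_foralln => k; case: choice.unpickle => [q|]; first exact: ae_q.
  exact: aeW.
apply: filterS => w h; apply: tuple_law_unique => q.
by have := h (choice.pickle q); rewrite choice.pickleK.
Qed.

End noise_law.

(** * Probability bounds *)

Section type_probability.
Context {R : realType} {dO : measure_display} {Omega : measurableType dO}.
Variable P : probability Omega R.

Lemma expeRN_itv (a : \bar R) : (0 < a)%E ->
  exists2 u : R, expeR (- a) = u%:E & 0 <= u <= 1.
Proof.
case: a => [r| |]//= r0; last by exists 0; rewrite ?lexx ?ler01.
by exists (expR (- r)); rewrite // expR_ge0 -[leRHS]expR0 ler_expR oppr_le0 ltW.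
Qed.

(** On the set where P(E | G) >= 1 - e^-a, which has probability at least
1 - e^-b, the integral of P(E | G) is a lower bound of P(E); and
(1 - u) (1 - v) >= 1 - u - v. *)
Lemma of_type_probability (G : set (set Omega)) (a b : \bar R) (E : set Omega) :
  G `<=` measurable -> of_type P G a b E ->
  (1 - expeR (- a) - expeR (- b) <= P E)%E.
Proof.
move=> Gm [a_gt0 b_gt0 mE [g [gG gi gint] h]].
have [u uE /andP[u0 u1]] := expeRN_itv a_gt0.
have [v vE /andP[v0 v1]] := expeRN_itv b_gt0.
rewrite uE vE -!EFinB in h *.
pose A := g @^-1` `[(1 - u)%:E, +oo[.
have AE : A = [set w | ((1 - u)%:E <= g w)%E].
  by apply/seteqP; split => w; rewrite /A/= in_itv/= andbT.
have GA : G A by apply: gG; exact: emeasurable_itv.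
have mA := Gm _ GA.
rewrite -AE in h.
apply: (@le_trans _ _ (P (E `&` A))); last first.
  by apply: le_measure; rewrite ?inE//; exact: measurableI.
rewrite -gint//; apply: (@le_trans _ _ (\int[P]_(w in A) (cst (1 - u)%:E) w)%E).
  rewrite integral_cst//; apply: (@le_trans _ _ ((1 - u)%:E * (1 - v)%:E)%E).
    by rewrite -EFinM lee_fin; nra.
  by rewrite lee_wpmul2l// lee_fin subr_ge0.
apply: le_integral => //.
- exact: finite_measure_integrable_cst.
- exact: integrableS gi.
- by move=> w; rewrite AE inE.
Qed.

End type_probability.

Section chebyshev.
Context {R : realType} {n : nat} (Q : probability (n.-tuple R) R).
Hypothesis Qint : gaussian_quad_moments Q.

Lemma measurable_quad_form_ge (b : 'I_n -> 'I_n -> R) a c (h : R) :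
  measurable [set t | h <= `|quad_form b a c t|].
Proof.
have m : measurable_fun setT (fun t => `|quad_form b a c t|).
  by apply: measurableT_comp => //; exact: measurable_quad_form.
have -> : [set t | h <= `|quad_form b a c t|] =
    setT `&` (fun t => `|quad_form b a c t|) @^-1` `[h, +oo[.
  by rewrite setTI; apply/seteqP; split => t /=; rewrite in_itv/= andbT.
by apply: m.
Qed.

Lemma quad_form_chebyshev (b : 'I_n -> 'I_n -> R) a (h : R) :
  (forall i j, b i j = b j i) -> 0 < h ->
  (Q [set t | (h <= `|quad_form b a 0 t|)%R] <=
   ((2 * \sum_i \sum_j b i j ^+ 2 + \sum_i a i ^+ 2) / h ^+ 2)%:E)%E.
Proof.
move=> b_sym h0; set A := [set t | _].
have mA : measurable A by exact: measurable_quad_form_ge.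
have mq : measurable_fun setT (fun t => ((quad_form b a 0 t) ^+ 2)%:E).
  apply/measurable_EFinP; apply: measurable_funX.
  exact: measurable_quad_form.
have : ((h ^+ 2)%:E * Q A <= \int[Q]_t ((quad_form b a 0 t) ^+ 2)%:E)%E.
  rewrite -integral_cst//; apply: (@le_trans _ _
    (\int[Q]_(t in A) ((quad_form b a 0 t) ^+ 2)%:E)%E).
    apply: ge0_le_integral => //.
    - by move=> t _; rewrite lee_fin sqr_ge0.
    - exact: measurable_funTS.
    - move=> t /= At; rewrite lee_fin -[leRHS]real_normK ?num_real//.
      by rewrite ler_pXn2r// nnegrE ltW.
  by apply: ge0_subset_integral => // t _; rewrite lee_fin sqr_ge0.
rewrite Qint// expr0n/= add0r.
by move=> ?; rewrite [leRHS]EFinM lee_pdivlMr ?exprn_gt0// muleC.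
Qed.

End chebyshev.

(** * Power of the test given the design and the sketch *)

Section test_power.
Context {R : realType}.

(** The normalizations cancel: n^-1 in beta_hat turns the values of K in f_hat
into entries of the empirical kernel matrix. *)
Lemma T_statE d n s (K : d.-tuple R -> d.-tuple R -> R) xs lam
    (S : 'M[R]_(s, n)) y :
  let D := Delta (gram K xs) lam S in
  T_stat K xs lam S y = n%:R^-1 * dot (D *m y) (D *m y).
Proof.
move=> D; rewrite /T_stat /emp_norm sqr_sqrtr; last first.
  by rewrite mulr_ge0 ?invr_ge0// sumr_ge0// => i _; rewrite sqr_ge0.
congr (_ * _); rewrite dotE; apply: eq_bigr => j _; rewrite expr2.
suff -> : f_hat K xs lam S y (xs j) = (D *m y) j 0 by [].
rewrite /f_hat /D /Delta /beta_hat -scalemxAr.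
set A := gram K xs; set N := invmx _.
have -> : A *m S^T *m N *m S *m A *m y = A *m (S^T *m (N *m S *m A *m y)).
  by rewrite !mulmxA.
rewrite [RHS]mxE; apply: eq_bigr => i _; rewrite mxE [A j i]mxE.
by ring.
Qed.

Section centered_statistic.
Variables (n : nat) (D : 'M[R]_n) (f : 'cV[R]_n).
Hypotheses (D_sym : D^T = D)
  (D_contract : forall v, dot (D *m v) (D *m v) <= dot v v).

Let b i j := n%:R^-1 * (D *m D) i j.
Let a i := 2 * n%:R^-1 * (D *m (D *m f)) i 0.
Let W := n%:R^-1 * dot (D *m f) (D *m f).
Let sigma := Num.sqrt (2 * \tr (D ^+ 4) / n%:R ^+ 2).

Lemma centered_statistic_quad_form (t : n.-tuple R) :
  let y := f + \col_i tnth t i in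
  n%:R^-1 * dot (D *m y) (D *m y) - \tr (D ^+ 2) / n%:R = quad_form b a W t.
Proof.
move=> y; pose e : 'cV[R]_n := \col_i tnth t i.
rewrite /y -/e mulmxDr !dot_lin (dotC (D *m e) (D *m f)).
rewrite !(dot_mulmxr D e) D_sym.

have -> : dot (D *m (D *m f)) e = \sum_i (D *m (D *m f)) i 0 * tnth t i.
  by rewrite dotE; apply: eq_bigr => i _; rewrite [e _ _]mxE.
have -> : dot (D *m (D *m e)) e =
    \sum_i \sum_j (D *m D) i j * tnth t i * tnth t j.
  rewrite dotC mulmxA dotE; apply: eq_bigr => i _.
  rewrite [(_ *m e) _ _]mxE mulr_sumr.
  by apply: eq_bigr => j _; rewrite /e !mxE; ring.
rewrite /quad_form /W /a /b.
have -> : \sum_i \sum_j n%:R^-1 * (D *m D) i j * tnth t i * tnth t j =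
    n%:R^-1 * \sum_i \sum_j (D *m D) i j * tnth t i * tnth t j.
  rewrite mulr_sumr; apply: eq_bigr => i _; rewrite mulr_sumr.
  by apply: eq_bigr => j _; rewrite !mulrA.
have -> : \sum_i n%:R^-1 * (D *m D) i i = n%:R^-1 * \tr (D ^+ 2).
  by rewrite mulr_sumr.
have -> : \sum_i 2 * n%:R^-1 * (D *m (D *m f)) i 0 * tnth t i =
    2 * n%:R^-1 * \sum_i (D *m (D *m f)) i 0 * tnth t i.
  by rewrite mulr_sumr; apply: eq_bigr => i _; rewrite !mulrA.
ring.
Qed.

Lemma centered_statistic_sym i j : b i j = b j i.
Proof.
rewrite /b; congr (_ * _).
by rewrite -[in RHS](trmxK (D *m D)) [RHS]mxE trmx_mul D_sym.
Qed.

(** The linear part of T - mu is 2 (Delta^2 f) . e / n, and |Delta^2 f| is at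
most |Delta f|. *)
Lemma centered_statistic_variance :
  2 * \sum_i \sum_j b i j ^+ 2 + \sum_i a i ^+ 2 <=
  sigma ^+ 2 + 4 * n%:R^-1 * W.
Proof.
have trE : \tr (D ^+ 4) = \sum_i \sum_j (D *m D) i j ^+ 2.
  have -> : D ^+ 4 = (D *m D) *m (D *m D).
    by rewrite -[D ^+ 4]/(D *m (D *m (D *m D))) !mulmxA.
  apply: eq_bigr => i _; rewrite mxE; apply: eq_bigr => j _.
  rewrite expr2; congr (_ * _).
  by rewrite -[in LHS](trmxK (D *m D)) [LHS]mxE trmx_mul D_sym.
rewrite /sigma sqr_sqrtr trE; last first.
  rewrite divr_ge0 ?exprn_ge0// mulr_ge0// sumr_ge0// => i _.
  by rewrite sumr_ge0// => j _; rewrite sqr_ge0.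
apply: lerD.
  rewrite /b -mulrA mulr_suml le_eqVlt.
  apply/orP; left; apply/eqP; congr (2 * _).
  apply: eq_bigr => i _; rewrite mulr_suml; apply: eq_bigr => j _.
  by rewrite exprMn exprVn mulrC.
have -> : \sum_i a i ^+ 2 =
    4 * n%:R^-1 * (n%:R^-1 * dot (D *m (D *m f)) (D *m (D *m f))).
  by rewrite dotE !mulr_sumr; apply: eq_bigr => i _; rewrite /a; ring.
by rewrite /W !ler_wpM2l ?mulr_ge0 ?invr_ge0.
Qed.

(** The mean W of T - mu is at least twice the threshold z sigma, so a
non-rejection forces a deviation of at least W / 2, whose probability is at most
4 (sigma^2 + 4 W / n) / W^2 <= (4 c2^2 + 16) / tau. *)
Lemma power_bound (Q : probability (n.-tuple R) R) (z c2 tau r eps : R) :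
  gaussian_quad_moments Q ->
  0 < r -> n%:R^-1 <= r -> sigma <= c2 * r -> tau * r <= W -> 0 < eps ->
  1 <= tau -> 2 * `|z| * c2 <= tau -> (4 * c2 ^+ 2 + 16) / eps <= tau ->
  ((1 - eps)%:E <= Q [set t | (z * sigma <= `|quad_form b a W t|)%R])%E.
Proof.
move=> Qint r0 nr sr Wr eps0 tau1 tauz taue.
set A := [set t | _].
have mA : measurable A by exact: measurable_quad_form_ge.
have s0 : 0 <= sigma by exact: sqrtr_ge0.
have tau0 : 0 < tau by lra.
have W0 : 0 < W by apply: lt_le_trans Wr; rewrite mulr_gt0.
have zs : z * sigma <= W / 2.
  apply: (@le_trans _ _ (`|z| * sigma)); first by rewrite ler_wpM2r// ler_norm.
  apply: (@le_trans _ _ (`|z| * (c2 * r))); first by rewrite ler_wpM2l.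
  by rewrite ler_pdivlMr//; apply: le_trans Wr; nra.
have h0 : 0 < W / 2 by rewrite divr_gt0.
have sub : ~` A `<=` [set t | W / 2 <= `|quad_form b a 0 t|].
  move=> t /= /negP; rewrite -ltNge => At.
  have qE : quad_form b a W t = W + quad_form b a 0 t.
    by rewrite /quad_form; ring.
  move: At; rewrite qE; move: (quad_form _ _ _ _) => q.
  have := ler_norm (W + q); have := ler_norm (- q); rewrite normrN; lra.
have AC : (Q (~` A) <= eps%:E)%E.
  apply: (@le_trans _ _ (Q [set t | (W / 2 <= `|quad_form b a 0 t|)%R])).
    apply: le_measure; rewrite ?inE//; first exact: measurableC.
    exact: measurable_quad_form_ge.
  apply: le_trans (quad_form_chebyshev Qint a centered_statistic_sym h0) _.
  rewrite lee_fin ler_pdivrMr ?exprn_gt0//.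
  apply: le_trans centered_statistic_variance _.
  have s2 : sigma ^+ 2 <= c2 ^+ 2 * r ^+ 2.
    by rewrite -exprMn ler_pXn2r// nnegrE (le_trans s0).
  have nW : n%:R^-1 * W <= r * W by rewrite ler_wpM2r// ltW.
  have rW : r <= W by apply: le_trans Wr; rewrite ler_peMl// ltW.
  move: taue; rewrite ler_pdivrMr// => taue.
  have := ler_wpM2r (mulr_ge0 (ltW r0) (ltW W0)) taue.
  have := ler_wpM2l (mulr_ge0 (ltW eps0) (ltW W0)) Wr.
  have := ler_wpM2l (mulr_ge0 (sqr_ge0 c2) (ltW r0)) rW.
  move: s2 nW; rewrite -[4 * _ * W]mulrA.
  set u := sigma ^+ 2; set v := n%:R^-1 * W; move=> s2 nW; nra.
have mC := probability_setC Q mA.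
move: AC; rewrite mC leeBlDr; last exact: fin_num_measure.
by move=> AC; rewrite EFinB leeBlDr// addeC.
Qed.

End centered_statistic.
End test_power.

(** * Counting the eigenvalues above the threshold *)

Section asymptotics.
Context {R : realType}.

Lemma Theta_nat (f g : nat -> R) :
  (f : nat -> R^o) =Theta_\oo (g : nat -> R^o) ->
  exists c : R * R, [/\ 0 < c.1, 0 < c.2 &
    exists N, forall n, (N <= n)%N ->
      c.1 * `|g n| <= `|f n| /\ `|f n| <= c.2 * `|g n|].
Proof.
rewrite eqThetaE qualifE => /asboolP[c /andP[c1 c2] [N _ h]].
by exists c; split => //; exists N => n Nn; exact: (h n).
Qed.

Lemma near_oo_exists (Pr : nat -> Prop) : (\forall n \near \oo, Pr n) ->
  exists N, forall n, (N <= n)%N -> Pr n.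
Proof. by move=> [N _ h]; exists N => n; exact: h. Qed.

Lemma eventually_nat (a : R) : exists N, forall n, (N <= n)%N -> a <= n%:R.
Proof.
exists (Num.truncn `|a|).+1 => n Nn; apply: le_trans (ler_norm a) _.
apply: le_trans (ltW (truncnS_gt _)) _; by rewrite ler_nat.
Qed.

Lemma eventually_ln : exists N, forall n, (N <= n)%N -> 1 <= ln (n%:R : R).
Proof.
have [N hN] := eventually_nat (expR 1); exists N => n /hN en.
by rewrite -[leLHS]expRK ler_ln ?posrE ?expR_gt0// (lt_le_trans (expR_gt0 1)).
Qed.

(** With t = (2 log n / gamma)^(1/p) and k + 1 >= t one has
mu_k <= C exp (- gamma t^p) = C / n^2, which is eventually below lam since lam
is at least of order 1 / n. The shift by k0 skips the indices for which the
asymptotic upper bound on mu_k is not yet valid. *)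
Lemma exponential_decay_count (gamma p : R) (mu lam : nat -> R) :
  0 < gamma -> 1 <= p -> (forall i, 0 <= mu i) -> (forall n, 0 < lam n) ->
  (mu : nat -> R^o) =Theta_\oo
    ((fun i => expR (- (gamma * i.+1%:R `^ p))) : nat -> R^o) ->
  (lam : nat -> R^o) =Theta_\oo
    ((fun n => ln n%:R `^ (2 * p)^-1 * n%:R^-1) : nat -> R^o) ->
  exists2 C1 : R, 0 < C1 & exists N, forall n, (N <= n)%N ->
    exists2 k, mu k <= lam n & k.+1%:R <= C1 * ln n%:R `^ p^-1.
Proof.
move=> gamma0 p1 mu0 lam0 /Theta_nat[[? Cm] [/= _ Cm0 [k0 hmu]]].
move=> /Theta_nat[[cl ?] [/= cl0 _ [N0 hlam]]].
have p0 : 0 < p by lra.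
have [N1 hN1] := eventually_ln.
have [N2 hN2] := eventually_nat (Cm / cl).
exists (k0.+1%:R + (2 / gamma) `^ p^-1).
  by rewrite ltr_pwDl// powR_ge0.
exists (maxn N0 (maxn N1 N2)) => n; rewrite !geq_max.
move=> /and3P[/hlam[+ _] /hN1 L1 /hN2 nC].
set L := ln n%:R in L1 *.
have n0 : (0 : R) < n%:R.
  by rewrite ltr0n lt0n; apply: contraTneq L1 => n0; rewrite /L n0 ln0// -ltNge.
rewrite (ger0_norm (ltW (lam0 n))) ger0_norm ?mulr_ge0 ?powR_ge0 ?invr_ge0//.
move=> lam_ge.
have Lge q : 0 <= q -> 1 <= L `^ q.
  by move=> q0; rewrite -(powRr0 L); apply: ler_powR.
pose t := (2 / gamma * L) `^ p^-1.
have tE : t = (2 / gamma) `^ p^-1 * L `^ p^-1.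
  by rewrite /t powRM// ?divr_ge0//; lra.
have t0 : 0 <= t by exact: powR_ge0.
exists (k0 + Num.truncn t)%N; last first.
  rewrite mulrDl -tE -addSn natrD lerD//.
    by rewrite ler_peMr// Lge// invr_ge0 ltW.
  by rewrite truncn_le.
apply: le_trans (_ : cl * n%:R^-1 <= _); last first.
  apply: le_trans lam_ge; rewrite ler_wpM2l ?(ltW cl0)// ler_peMl ?invr_ge0//.
  by rewrite Lge// invr_ge0; lra.
set k := (k0 + _)%N.
have [_] := hmu k (leq_addr _ _).
rewrite (ger0_norm (mu0 k)) ger0_norm ?expR_ge0// => /le_trans; apply.
have kt : t <= k.+1%:R.
  apply: le_trans (ltW (truncnS_gt t)) _; by rewrite ler_nat ltnS leq_addl.
have kp : 2 * L <= gamma * k.+1%:R `^ p.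
  have : t `^ p <= k.+1%:R `^ p.
    by apply: ge0_ler_powR; rewrite ?nnegrE ?(ltW p0).
  rewrite /t -powRrM mulVf ?gt_eqF// powRr1; last first.
    by rewrite mulr_ge0 ?divr_ge0; lra.
  move=> /(ler_wpM2l (ltW gamma0)); apply: le_trans.
  by rewrite le_eqVlt; apply/orP; left; apply/eqP; field; rewrite gt_eqF.
apply: (@le_trans _ _ (Cm * expR (- (2 * L)))).
  by rewrite ler_wpM2l ?(ltW Cm0)// ler_expR lerN2.
have -> : expR (- (2 * L)) = n%:R^-1 * n%:R^-1.
  by rewrite expRN mulr_natl mulr2n expRD /L lnK ?posrE// invfM.
by rewrite mulrA ler_wpM2r ?invr_ge0// ler_pdivrMr// mulrC -ler_pdivrMr.
Qed.

End asymptotics.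

(** * Rejection at a satisfiable outcome *)

Section rejection.
Context {R : realType} {d n s : nat}.
Local Notation pt := (d.-tuple R).
Variables (X : set pt) (H : set (pt -> R)) (ip : (pt -> R) -> (pt -> R) -> R).
Variables (K : pt -> pt -> R) (xs : 'I_n -> pt) (lam c : R) (S : 'M[R]_(s, n)).
Hypotheses (HK : is_rkhs X H ip K) (Xxs : forall i, X (xs i)).
Hypotheses (lam_gt0 : 0 < lam) (c_gt0 : 0 < c).
Hypothesis M_unit : sketched (gram K xs) lam S \in unitmx.
Hypothesis sat : satisfiable (gram K xs) lam c S.

Local Notation A := (gram K xs).
Local Notation Delta := (Delta A lam S).

Lemma satisfiable_sym : A^T = A.
Proof. by have [U [D [AUD _]]] := sat; exact: spectral_sym AUD. Qed.

Lemma satisfiable_ge0 v : 0 <= dot v (A *m v).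
Proof. by have [U [D [AUD _]]] := sat; exact: (spectral_ge0 AUD). Qed.

(** Mercer's expansion cut at the first k + 1 terms: each term kept contributes
at most 1 to tr Delta, and the trace of what is dropped is of order
(k + 1) mu_k, whatever the design points. *)
Lemma mxtrace_Delta4_gram (mu : nat -> R) (phi : nat -> pt -> R) (M M' : R) k :
  (forall i, 0 <= mu i) ->
  (forall x y, X x -> X y ->
     series (fun i => mu i * phi i x * phi i y) @ \oo --> K x y) ->
  (forall i x, X x -> `|phi i x| <= M) ->
  (\sum_(k.+1 <= i <oo) (mu i)%:E <= (M' * (k.+1%:R * mu k))%:E)%E ->
  mu k <= lam ->
  \tr (Delta ^+ 4) <= (1 + M ^+ 2 * `|M'|) * k.+1%:R.
Proof.
move=> mu_ge0 mercer phi_le tail_le mu_lam.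
have [U [D [AUD _]]] := sat; have [Q Q_sym AQ] := spectral_sqrt AUD.
apply: le_trans
  (mxtrace_Delta4_le satisfiable_sym satisfiable_ge0 lam_gt0 M_unit) _.
have Phi_le v := mercer_factor_le mu_ge0 mercer k.+1 v Xxs.
apply: le_trans
  (mxtrace_Delta_le satisfiable_sym lam_gt0 M_unit Q_sym AQ Phi_le) _.
rewrite [leRHS]mulrDl mul1r lerD2l mulrC ler_pdivrMr//.
apply: le_trans (mercer_tail_le mu_ge0 mercer Xxs phi_le tail_le) _.
have -> : M ^+ 2 * `|M'| * k.+1%:R * lam = M ^+ 2 * (`|M'| * (k.+1%:R * lam)).
  by ring.
rewrite ler_wpM2l ?sqr_ge0//.
apply: (@le_trans _ _ (`|M'| * (k.+1%:R * mu k))).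
  by apply: ler_wpM2r; [rewrite mulr_ge0|exact: ler_norm].
by apply: ler_wpM2l => //; exact: ler_wpM2l.
Qed.

Lemma test_eventE (alpha : R) (f : pt -> R) :
  [set e | test alpha K xs lam S (\col_i (f (xs i) + tnth e i)%R)] =
  [set e | normal_quantile (1 - alpha / 2) *
      Num.sqrt (2 * \tr (Delta ^+ 4) / n%:R ^+ 2) <=
    `|quad_form (fun i j => n%:R^-1 * (Delta *m Delta) i j)
       (fun i => 2 * n%:R^-1 * (Delta *m (Delta *m \col_i f (xs i))) i 0)
       (n%:R^-1 * dot (Delta *m \col_i f (xs i)) (Delta *m \col_i f (xs i)))
       e|].
Proof.
have D_sym := Delta_sym S lam satisfiable_sym.
apply/seteqP; split => e /=.
all: rewrite /test T_statE /mu_stat -centered_statistic_quad_form//.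
all: have -> : \col_i (f (xs i) + tnth e i) = \col_i f (xs i) + \col_i tnth e i
  by apply/colP => i; rewrite !mxE.
all: by [].
Qed.

Lemma measurable_test (alpha : R) (f : pt -> R) :
  measurable [set e | test alpha K xs lam S (\col_i (f (xs i) + tnth e i)%R)].
Proof. by rewrite test_eventE; exact: measurable_quad_form_ge. Qed.

(** From |f|^2 <= 2 |Delta f|^2 + 2 |f - Delta f|^2, the separation assumed on f
leaves W >= tau r once the bias is subtracted. *)
Lemma rejection_power (Q : probability (n.-tuple R) R)
    (alpha C Cl c2 tau r eps : R) (f : pt -> R) :
  gaussian_quad_moments Q ->
  0 < r -> (0 < n)%N -> n%:R^-1 <= r -> lam <= Cl * r ->
  0 <= c2 -> 2 * \tr (Delta ^+ 4) <= c2 ^+ 2 * (n%:R * r) ^+ 2 ->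
  0 < eps -> 1 <= tau ->
  2 * `|normal_quantile (1 - alpha / 2)| * c2 <= tau ->
  (4 * c2 ^+ 2 + 16) / eps <= tau ->
  H f -> Num.sqrt (ip f f) <= C ->
  2 * (tau + (3 + 6 * c ^+ 2) * C ^+ 2 * Cl) * r <= emp_norm xs f ^+ 2 ->
  ((1 - eps)%:E <=
   Q [set e | test alpha K xs lam S (\col_i (f (xs i) + tnth e i)%R)])%E.
Proof.
move=> Qint r_gt0 n_gt0 nr lam_le c2_ge0 tr_le eps_gt0 tau1 tauz taue.
move=> Hf fC f_large.
have nR_gt0 : (0 : R) < n%:R by rewrite ltr0n.
pose fv : 'cV[R]_n := \col_i f (xs i).
have D_sym := Delta_sym S lam satisfiable_sym.
have D_contract :=
  dot_Delta_contract satisfiable_sym satisfiable_ge0 lam_gt0 M_unit.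
set D := Defs.Delta A lam S in D_sym D_contract *.
have ip_ge0 : 0 <= ip f f by exact: (rkhs_ip_ge0 HK).
have ip_le : ip f f <= C ^+ 2.
  rewrite -(sqr_sqrtr ip_ge0) ler_pXn2r// ?nnegrE ?sqrtr_ge0//.
  exact: le_trans (sqrtr_ge0 _) fC.
have bias : dot (fv - D *m fv) (fv - D *m fv) <=
    (3 + 6 * c ^+ 2) * (lam * (n%:R * ip f f)).
  apply: (satisfiable_bias lam_gt0 c_gt0 _ M_unit sat).
    by rewrite mulr_ge0.
  by move=> a; exact: (rkhs_eval_le HK).
have fvE : dot fv fv = n%:R * emp_norm xs f ^+ 2.
  rewrite /emp_norm sqr_sqrtr; last first.
    by rewrite mulr_ge0 ?invr_ge0// sumr_ge0// => i _; rewrite sqr_ge0.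
  rewrite mulrA mulfV ?mul1r ?gt_eqF// dotE; apply: eq_bigr => i _.
  by rewrite !mxE expr2.
have signal : tau * r <= n%:R^-1 * dot (D *m fv) (D *m fv).
  have par : dot fv fv <=
      2 * dot (D *m fv) (D *m fv) + 2 * dot (fv - D *m fv) (fv - D *m fv).
    have := dot_ge0 (fv - 2 *: (D *m fv)).
    by rewrite !dot_lin (dotC _ fv); lra.
  have lamip : lam * ip f f <= Cl * r * C ^+ 2.
    apply: (@le_trans _ _ (lam * C ^+ 2)); first by rewrite ler_wpM2l// ltW.
    by rewrite ler_wpM2r// sqr_ge0.
  have c3 : 0 <= 3 + 6 * c ^+ 2 by rewrite addr_ge0// mulr_ge0// sqr_ge0.
  have := ler_wpM2l c3 lamip; move: bias par.
  rewrite fvE (mulrCA lam) (mulrCA _ n%:R).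
  set a := dot (D *m fv) (D *m fv); set b := dot (fv - _) _.
  set u := _ * (lam * _) => bias par u_le.
  have : n%:R * emp_norm xs f ^+ 2 <= n%:R * (2 * (n%:R^-1 * a) + 2 * u).
    have -> : n%:R * (2 * (n%:R^-1 * a) + 2 * u) = 2 * a + 2 * (n%:R * u).
      by field; rewrite gt_eqF.
    by apply: le_trans par _; rewrite lerD2l ler_wpM2l.
  rewrite ler_pM2l// => emp_le; have := le_trans f_large emp_le; nra.
have sigma_le : Num.sqrt (2 * \tr (D ^+ 4) / n%:R ^+ 2) <= c2 * r.
  rewrite -[leRHS]ger0_norm ?mulr_ge0 ?(ltW r_gt0)// -sqrtr_sqr ler_wsqrtr//.
  rewrite ler_pdivrMr ?exprn_gt0//.
  by have -> : (c2 * r) ^+ 2 * n%:R ^+ 2 = c2 ^+ 2 * (n%:R * r) ^+ 2 by ring.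
have := power_bound D_sym D_contract Qint r_gt0 nr sigma_le signal eps_gt0
  tau1 tauz taue.
by rewrite test_eventE.
Qed.

End rejection.

(** * The uniform power bound *)

Unset Implicit Arguments.
Set Strict Implicit.
Set Printing Implicit Defensive.

Theorem corollary4p12 (R : realType) (gamma p : R)
    (gamma_gt0 : 0 < gamma) (p_ge1 : 1 <= p) :
  exists2 c_gp : R, 0 < c_gp &
  forall (d : nat) (d_gt0 : (0 < d)%N)
    (X : set (d.-tuple R)) (X_meas : measurable X)
    (PX : probability (d.-tuple R) R) (PX_X : PX X = 1%E)
    (H : set (d.-tuple R -> R)) (ip : (d.-tuple R -> R) -> (d.-tuple R -> R) -> R)
    (K : d.-tuple R -> d.-tuple R -> R)
    (mu : nat -> R) (phi : nat -> d.-tuple R -> R),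
  is_rkhs X H ip K ->
  (forall f, H f -> in_L2 X PX f) ->
  is_eigensystem X PX H ip K mu phi ->
  assumption_A1 X mu phi ->
  (mu : nat -> R^o) =Theta_\oo
    ((fun i => expR (- (gamma * i.+1%:R `^ p))) : nat -> R^o) ->
  exists2 dd : R, 0 < dd &
  forall (dO : measure_display) (Omega : measurableType dO)
    (P : probability Omega R)
    (x : nat -> {RV P >-> d.-tuple R}) (noise : nat -> {RV P >-> R})
    (s : nat -> nat) (S : forall n, Omega -> 'M[R]_(s n, n))
    (kap : forall n, Omega -> probability (n.-tuple R) R)
    (lam : nat -> R) (alpha C c : R) (c1 c2 : \bar R),
  is_model x noise S X PX ->
  (forall n, is_regular_cond_dist P (sigma_xS x S n) (noise_tuple noise n) (kap n)) ->
  0 < alpha < 1 ->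
  0 < C ->
  0 < c ->
  (0 < c1)%E ->
  (0 < c2)%E ->
  (forall n, 0 < lam n) ->
  (lam : nat -> R^o) =Theta_\oo
    ((fun n => ln n%:R `^ (2 * p)^-1 * n%:R^-1) : nat -> R^o) ->
  (\forall n \near \oo, estimator_well_defined x S K lam n) ->
  (\forall n \near \oo, assumption_A2 x S K mu lam dd c c1 c2 n) ->
  forall eps : R, 0 < eps ->
  exists (C_eps : R) (N_eps : nat), 0 < C_eps /\
  forall n : nat, (N_eps <= n)%N ->
  exists E : set Omega,
    [/\ measurable E,
        (1 - (expR (- (c_gp * n%:R * ln n%:R `^ (- 2 / p))))%:E
           - expeR (- (c1 * (s n)%:R%:E))
           - expeR (- (c2 * (slam mu (lam n))%:R%:E)) < P E)%E
      & forall w, E w ->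
        ((1 - eps)%:E <=
         ereal_inf [set cond_power x S kap alpha K lam n w f | f in
           alternatives x H ip C
             (C_eps * n%:R `^ (- 2^-1) * ln n%:R `^ (4 * p)^-1)%R n w])%E].
Proof.
exists 1; first exact: ltr01.
move=> d d_gt0 X X_meas PX PX_X H ip K mu phi HK _ HE.
move=> [[M phi_le] [M' tail_le]] mu_theta.
exists 1; first exact: ltr01.
move=> dO Omega P x noise s S kap lam alpha C c c1 c2 HM Hkap _ _ c_gt0 _ _
  lam_gt0 lam_theta wd A2 eps eps_gt0.
have p_gt0 : 0 < p by exact: lt_le_trans p_ge1.
have mu_ge0 := eigen_ge0 HE.
have [C1 C1_gt0 [N1 count]] :=
  exponential_decay_count gamma_gt0 p_ge1 mu_ge0 lam_gt0 mu_theta lam_theta.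
have [[cl Cl] [/= _ Cl_gt0 [N2 lam_le]]] := Theta_nat lam_theta.
have [N3 ln_ge1] := @eventually_ln R.
have [N4 {}wd] := near_oo_exists wd.
have [N5 {}A2] := near_oo_exists A2.
pose c2' := Num.sqrt (2 * ((1 + M ^+ 2 * `|M'|) * C1)).
pose z := normal_quantile (1 - alpha / 2).
(* tau is the signal-to-r ratio required by power_bound, beta the bias-to-r
   ratio; the separation constant is sqrt (2 (tau + beta)). *)
pose tau := 1 + 2 * `|z| * c2' + (4 * c2' ^+ 2 + 16) / eps.
pose beta := (3 + 6 * c ^+ 2) * C ^+ 2 * Cl.
have tr_ge0 : 0 <= 1 + M ^+ 2 * `|M'|.
  by rewrite addr_ge0// mulr_ge0// sqr_ge0.
have c2'_ge0 : 0 <= c2' by exact: sqrtr_ge0.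
have c2'_sqr : c2' ^+ 2 = 2 * ((1 + M ^+ 2 * `|M'|) * C1).
  by rewrite sqr_sqrtr// mulr_ge0// mulr_ge0// ltW.
have tauz : 0 <= 2 * `|z| * c2' by rewrite mulr_ge0// mulr_ge0.
have taue : 0 <= (4 * c2' ^+ 2 + 16) / eps.
  by rewrite divr_ge0 ?(ltW eps_gt0)// addr_ge0// mulr_ge0// sqr_ge0.
have beta_ge0 : 0 <= beta.
  rewrite mulr_ge0 ?(ltW Cl_gt0)// mulr_ge0 ?sqr_ge0// addr_ge0//.
  by rewrite mulr_ge0// sqr_ge0.
have sep_gt0 : 0 < 2 * (tau + beta) by rewrite /tau; lra.
exists (Num.sqrt (2 * (tau + beta))).
exists (maxn N1 (maxn N2 (maxn N3 (maxn N4 N5)))).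
split; first by rewrite sqrtr_gt0.
move=> n; rewrite !geq_max => /and5P[nN1 nN2 nN3 nN4 nN5].
have ln1 := ln_ge1 n nN3.
have n_gt0 : (0 < n)%N.
  by rewrite lt0n; apply: contraTneq ln1 => ->; rewrite ln0// -ltNge.
have [Q Qbox Qint] := @exists_gaussian_tuple R n.
have sat_type := (A2 n nN5).2.
have sat_meas : measurable (sketch_satisfiable x S K lam c n) by case: sat_type.
have [N [N_meas PN0 subN]] : {ae P, forall w,
    sketched (gram K (design x w)) (lam n) (S n w) \in unitmx /\
    (forall A, measurable A -> kap n w A = Q A)}.
  exact: filterI (wd n nN4) (kernel_ae_gaussian HM (Hkap n) Qbox).
exists (sketch_satisfiable x S K lam c n `\` N); split.
- exact: measurableD.
- have le_PE : (P (sketch_satisfiable x S K lam c n) <=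
      P (sketch_satisfiable x S K lam c n `\` N))%E.
    rewrite -(measureU0 (measurableD sat_meas N_meas) N_meas PN0).
    apply: le_measure; rewrite ?inE//.
      by apply: measurableU => //; exact: measurableD.
    by move=> w satw; have [Nw|Nw] := pselect (N w); [right|left].
  apply: lt_le_trans le_PE.
  apply: lt_le_trans (of_type_probability _ sat_type); last first.
    exact: sigma_x_measurable.
  have [a_gt0 b_gt0 _ _] := sat_type.
  have [u -> _] := expeRN_itv a_gt0; have [v -> _] := expeRN_itv b_gt0.
  by rewrite -!EFinB lte_fin !ltrD2r gtrBl expR_gt0.
- move=> w [satw Nw].
  have [unitw kapw] :
      sketched (gram K (design x w)) (lam n) (S n w) \in unitmx /\
      (forall A, measurable A -> kap n w A = Q A).
    by apply: contrapT => bad; apply: Nw; exact: subN.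
  apply: le_ereal_inf_tmp => _ [f [Hf fC f_large] <-].
  have Xxs (i : 'I_n) : X (design x w i) by exact: (model_x_dom HM).
  rewrite /cond_power /response kapw; last exact: (measurable_test satw).
  have [k mu_lam k_le] := count n nN1.
  pose L := ln (n%:R : R); pose r := L `^ (2 * p)^-1 * n%:R^-1.
  have L_gt0 : 0 < L by exact: lt_le_trans ln1.
  have nR_gt0 : (0 : R) < n%:R by rewrite ltr0n.
  have r_gt0 : 0 < r by rewrite mulr_gt0 ?powR_gt0 ?invr_gt0.
  have LE : (L `^ (2 * p)^-1) ^+ 2 = L `^ p^-1.
    rewrite -powR_mulrn ?powR_ge0// -powRrM; congr (_ `^ _).
    by field; rewrite gt_eqF.
  apply: (@rejection_power _ _ _ _ X H ip K _ (lam n) c _ HK Xxs (lam_gt0 n)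
    c_gt0 unitw satw Q alpha C Cl c2' tau r eps f) => //.
  + rewrite /r ler_peMl ?invr_ge0// -[leLHS](powRr0 L); apply: ler_powR => //.
    by rewrite invr_ge0; lra.
  + have [_] := lam_le n nN2; rewrite (ger0_norm (ltW (lam_gt0 n))) ger0_norm//.
    exact: ltW.
  + rewrite c2'_sqr -mulrA ler_wpM2l//.
    apply: le_trans (mxtrace_Delta4_gram Xxs (lam_gt0 n) unitw satw mu_ge0
      (eigen_mercer HE) phi_le (tail_le k) mu_lam) _.
    have -> : n%:R * r = L `^ (2 * p)^-1.
      by rewrite /r mulrCA mulfV ?gt_eqF// mulr1.
    rewrite LE -mulrA.
    by rewrite ler_wpM2l.
  + by rewrite /tau; lra.
  + by rewrite /tau -/z; lra.
  + by rewrite /tau; lra.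
  + have n_half : (n%:R `^ (- 2^-1)) ^+ 2 = n%:R^-1 :> R.
      by rewrite -powR_mulrn ?powR_ge0// -powRrM mulNr mulVf// powR_inv1.
    have L_quarter : (L `^ (4 * p)^-1) ^+ 2 = L `^ (2 * p)^-1.
      rewrite -powR_mulrn ?powR_ge0// -powRrM; congr (_ `^ _).
      by field; rewrite gt_eqF.
    have -> : 2 * (tau + (3 + 6 * c ^+ 2) * C ^+ 2 * Cl) * r =
        (Num.sqrt (2 * (tau + beta)) * n%:R `^ (- 2^-1) * L `^ (4 * p)^-1) ^+ 2.
      rewrite !exprMn sqr_sqrtr ?(ltW sep_gt0)// n_half L_quarter /r.
      by rewrite mulrAC mulrA.
    rewrite ler_pXn2r// nnegrE ?sqrtr_ge0//.
    by rewrite mulr_ge0 ?powR_ge0// mulr_ge0 ?powR_ge0// sqrtr_ge0.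
Qed.
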